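(* Let $\Gamma$ be a finitely generated discrete group, $H$ a compact Lie group with its Haar probability measure, $K\in\mathbb N$, and $\rho:\Gamma\to C(H,U_K)$ an injective group morphism, written $\rho(g)=(x\mapsto g^x)$. Let $\pi:C^*(\Gamma)\to M_K(C(H))$ be the matrix model induced by $\rho$. Then $\pi$ is stationary when $$\int_Htr(g^x)\,dx=0\quad\text{for all } g\in\Gamma,\ g\neq1.$$ Moreover, every finitely generated abelian group $\Gamma$, and every finite group $\Gamma$, admits such a model $\rho:\Gamma\subset C(H,U_K)$ (for some compact Lie group $H$ and some $K\in\mathbb N$) satisfying this condition.
   Context: For a discrete group $\Gamma$, $C^*(\Gamma)$ is the full group $C^*$-algebra, viewed as $C(G)$ for the abstract dual compact quantum group $G=\widehat\Gamma$; its Haar integration $\int_G$ is given on group elements by $g\mapsto\delta_{g,1}$. $C(H,U_K)$ is the group of continuous functions $H\to U_K$ under pointwise multiplication, i.e. the unitary group of $M_K(C(H))$. Here $tr$ is the normalized trace on $M_K(\mathbb C)$, and $tr\otimes\int_H$ is the functional $f\mapsto\int_Htr(f(x))\,dx$ on $M_K(C(H))$. The model $\pi$ is called stationary if $\int_G=(tr\otimes\int_H)\pi$. Finite groups (including the trivial group) count as compact Lie groups. *)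

(* Defs.v *)
From HB Require Import structures.
From mathcomp Require Import all_boot all_order all_algebra complex.
From mathcomp Require Import all_classical all_reals all_analysis.

Set Implicit Arguments.
Unset Strict Implicit.
Unset Printing Implicit Defensive.

Import Order.TTheory GRing.Theory Num.Theory.
Import numFieldNormedType.Exports.

Local Open Scope classical_set_scope.
Local Open Scope ring_scope.
Local Open Scope complex_scope.
Local Open Scope sesquilinear_scope.

HB.mixin Record Algebra_isStarAlgebra (R : realType) A
    of GRing.Algebra R[i] A := {
  star : A -> A;
  starK : involutive star;
  starD : {morph star : a b / a + b};
  starM : {morph star : a b / a * b >-> b * a};
  starZ : forall (l : R[i]) (a : A), star (l *: a) = Num.conj l *: star a
}.

#[short(type="starAlgType")]
HB.structure Definition StarAlgebra (R : realType) :=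
  {A of Algebra_isStarAlgebra R A & GRing.Algebra R[i] A}.

(* Hierarchy-Builder rejects a structure combining GRing.Algebra with
   NormedModule: its join of PzSemiRing and SemiNormedZmodule is missing below
   Num.NumDomain.  The norm is therefore a separate operation, and [banach A] is
   the carrier of A seen as a library normed module, with the norm topology.  As
   for all modules over R[i] in the library, the norm takes its (necessarily
   real and nonnegative) values in R[i]. *)
HB.mixin Record StarAlgebra_isPreCStar (R : realType) A of StarAlgebra R A := {
  cnorm : A -> R[i];
  cnormD : forall a b : A, cnorm (a + b) <= cnorm a + cnorm b;
  cnormZ : forall (l : R[i]) (a : A), cnorm (l *: a) = `|l| * cnorm a;
  cnorm0_eq0 : forall a : A, cnorm a = 0 -> a = 0;
  cnormM : forall a b : A, cnorm (a * b) <= cnorm a * cnorm b;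
  cnorm_star_mul : forall a : A, cnorm (star a * a) = cnorm a ^+ 2
}.

HB.structure Definition PreCStarAlgebra (R : realType) :=
  {A of StarAlgebra R A & StarAlgebra_isPreCStar R A}.

Definition banach (R : realType) (A : PreCStarAlgebra.type R) : Type := A.

HB.instance Definition _ (R : realType) (A : PreCStarAlgebra.type R) :=
  GRing.Lmodule.copy (banach A) A.
HB.instance Definition _ (R : realType) (A : PreCStarAlgebra.type R) :=
  Lmodule_isNormed.Build R[i] (banach A) (@cnormD R A) (@cnormZ R A)
    (@cnorm0_eq0 R A).

HB.mixin Record PreCStar_isCStar (R : realType) A of PreCStarAlgebra R A := {
  banach_complete : forall F : set_system (banach A),
    ProperFilter F -> cauchy F -> cvg F
}.

#[short(type="cstarAlgType")]
HB.structure Definition CStarAlgebra (R : realType) :=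
  {A of PreCStarAlgebra R A & PreCStar_isCStar R A}.

HB.instance Definition _ (R : realType) (A : cstarAlgType R) :=
  Uniform_isComplete.Build (banach A) (@banach_complete R A).


HB.mixin Record isTopologicalGroup G of Group G & Topological G := {
  mulg_continuous : continuous (fun p : G * G => (p.1 * p.2)%g);
  invg_continuous : continuous (fun x : G => (x^-1)%g)
}.

#[short(type="topologicalGroupType")]
HB.structure Definition TopologicalGroup :=
  {G of isTopologicalGroup G & Group G & Topological G}.

(* For U open: f has continuous iterated partial derivatives up to order r on U.
   Only the values of f near the points of U matter. *)
Fixpoint Cr_on (R : realType) (n m r : nat) (U : set 'rV[R]_n)
    (f : 'rV[R]_n -> 'rV[R]_m) : Prop :=
  (forall x, U x -> {for x, continuous f}) /\
  (if r is r'.+1 then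
     forall j : 'I_n, (forall x, U x -> derivable f x (delta_mx 0 j)) /\
                      Cr_on r' U ('D_(delta_mx 0 j) f)
   else True).

Definition smooth_on (R : realType) (n m : nat) (U : set 'rV[R]_n)
    (f : 'rV[R]_n -> 'rV[R]_m) : Prop := forall r, Cr_on r U f.

(* [chart_map] is only meaningful on [chart_dom], and [chart_inv] on the image
   of [chart_dom]; they take junk values elsewhere. *)
Record chart (R : realType) (T : Type) (n : nat) := Chart {
  chart_dom : set T;
  chart_map : T -> 'rV[R]_n;
  chart_inv : 'rV[R]_n -> T
}.

Definition chart_cod (R : realType) (T : Type) (n : nat) (c : chart R T n) :
  set 'rV[R]_n := chart_map c @` chart_dom c.

Definition is_chart (R : realType) (T : topologicalType) (n : nat)
    (c : chart R T n) : Prop :=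
  [/\ open (chart_dom c), open (chart_cod c),
      forall x, chart_dom c x -> chart_inv c (chart_map c x) = x,
      forall x, chart_dom c x -> {for x, continuous (chart_map c)} &
      forall y, chart_cod c y -> {for y, continuous (chart_inv c)}].

Definition smooth_transition (R : realType) (T : Type) (n : nat)
    (c d : chart R T n) : Prop :=
  smooth_on [set y | chart_cod c y /\ chart_dom d (chart_inv c y)]
    (fun y => chart_map d (chart_inv c y)).

Definition smooth_atlas (R : realType) (T : topologicalType) (n : nat)
    (A : set (chart R T n)) : Prop :=
  [/\ forall c, A c -> is_chart c,
      forall x, exists2 c, A c & chart_dom c x &
      forall c d, A c -> A d -> smooth_transition c d].

(* Smoothness of a map T * T -> T, resp. T -> T, read in the charts of A;
   R^n * R^n is identified with R^(n + n). *)
Definition smooth_map2 (R : realType) (T : Type) (n : nat)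
    (A : set (chart R T n)) (F : T -> T -> T) : Prop :=
  forall c d e, A c -> A d -> A e ->
    let G z := F (chart_inv c (lsubmx z)) (chart_inv d (rsubmx z)) in
    smooth_on
      [set z : 'rV[R]_(n + n) | [/\ chart_cod c (lsubmx z),
          chart_cod d (rsubmx z) & chart_dom e (G z)]]
      (fun z => chart_map e (G z)).

Definition smooth_map1 (R : realType) (T : Type) (n : nat)
    (A : set (chart R T n)) (F : T -> T) : Prop :=
  forall c d, A c -> A d ->
    smooth_on [set y | chart_cod c y /\ chart_dom d (F (chart_inv c y))]
      (fun y => chart_map d (F (chart_inv c y))).

(* A Lie group may have any dimension n >= 0 and any number of components; for
   n = 0 these are the discrete groups, so all finite groups are included. *)
HB.mixin Record isLieGroup (R : realType) G of TopologicalGroup G := {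
  lie_hausdorff : hausdorff_space G;
  lie_second_countable : @second_countable G;
  lie_dim : nat;
  lie_atlas : set (chart R G lie_dim);
  lie_smooth_atlas : smooth_atlas lie_atlas;
  lie_smooth_mul : smooth_map2 lie_atlas (fun x y : G => (x * y)%g);
  lie_smooth_inv : smooth_map1 lie_atlas (fun x : G => (x^-1)%g)
}.

#[short(type="lieGroupType")]
HB.structure Definition LieGroup (R : realType) :=
  {G of isLieGroup R G & TopologicalGroup G}.

HB.mixin Record isCompactGroup G of TopologicalGroup G := {
  compact_setT : compact [set: G]
}.

#[short(type="compactLieGroupType")]
HB.structure Definition CompactLieGroup (R : realType) :=
  {G of LieGroup R G & isCompactGroup G}.

(* The library's measurable types are pointed; we point a group at 1. *)
Definition pointed_group (H : topologicalGroupType) : Type := H.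
HB.instance Definition _ (H : topologicalGroupType) :=
  Topological.copy (pointed_group H) H.
HB.instance Definition _ (H : topologicalGroupType) :=
  isPointed.Build (pointed_group H) 1%g.

Definition borel (H : topologicalGroupType) :=
  g_sigma_algebraType (@open (pointed_group H)).
HB.instance Definition _ (H : topologicalGroupType) :=
  Measurable.on (borel H).

(* On a compact Lie group, which is second countable, every finite Borel measure
   is regular and a left invariant probability is also right invariant. *)
Definition haar_probability (R : realType) (H : topologicalGroupType)
    (mu : probability (borel H) R) : Prop :=
  forall (h : H) (A : set (borel H)), measurable A ->
    mu [set (h * x)%g | x in A] = mu A.

Definition cintegral (R : realType) (H : topologicalGroupType)
    (mu : probability (borel H) R) (f : H -> R[i]) : R[i] :=
  Rintegral mu setT (fun x => complex.Re (f x)) +i*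
  Rintegral mu setT (fun x => complex.Im (f x)).

(* Gives the concrete type R[i] the topology and norm that the library puts on
   an abstract numClosedFieldType. *)
HB.instance Definition _ (R : realType) := NormedModule.copy R[i] R[i]^o.

(* M_K(C(H)) with K = k.+1, as the algebra of continuous functions from H to
   M_K under pointwise operations and pointwise adjoint *)
Definition mxcont (R : realType) (H : topologicalGroupType) (k : nat) : Type :=
  continuousType H 'M[R[i]]_k.+1.

HB.instance Definition _ (R : realType) (H : topologicalGroupType) (k : nat) :=
  Choice.copy (mxcont R H k) (continuousType H 'M[R[i]]_k.+1).

Section MxCont.
Variables (R : realType) (H : topologicalGroupType) (k : nat).
Local Notation C := R[i].
Local Notation M := 'M[C]_k.+1.
Local Notation MC := (mxcont R H k).
Implicit Types f g h : MC.

Definition mxcont_fun f : H -> M := f.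
Coercion mxcont_fun : mxcont >-> Funclass.

Lemma mx_continuous (f : H -> M) :
  (forall i j, continuous (fun x => f x i j)) -> continuous f.
Proof.
move=> cf x A /= [P xP sPA].
suff : \forall y \near x, forall i j, P i j (f y i j) by apply: filterS => y /sPA.
by apply: filter_forall => i; apply: filter_forall => j; exact: (cf i j x _ (xP i j)).
Qed.

Lemma entry_continuous f i j : continuous (fun x => f x i j).
Proof.
move=> x; apply: (@continuous_comp _ _ _ (f : H -> M) (fun N : M => N i j)).
  exact: cts_fun.
exact: coord_continuous.
Qed.

Lemma mxcontP f g : f =1 g -> f = g.
Proof. by move/continuousEP. Qed.

Fact cst_cts (N : M) : continuous (fun _ : H => N).
Proof. exact: cst_continuous. Qed.
Fact add_cts f g : continuous (fun x => f x + g x).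
Proof.
apply: mx_continuous => i j.
rewrite (_ : (fun x => _) = (fun x => f x i j) \+ (fun x => g x i j)).
  by move=> x; apply: cvgD; exact: entry_continuous.
by apply/funext => x; rewrite mxE.
Qed.
Fact scale_cts (l : C) f : continuous (fun x => l *: f x).
Proof.
apply: mx_continuous => i j.
rewrite (_ : (fun x => _) = (fun=> l) \* (fun x => f x i j)).
  by move=> x; apply: cvgM; [exact: cvg_cst | exact: entry_continuous].
by apply/funext => x; rewrite mxE.
Qed.
Fact opp_cts f : continuous (fun x => - f x).
Proof.
rewrite (_ : (fun x => _) = (fun x => -1 *: f x)); first exact: scale_cts.
by apply/funext => x; rewrite scaleN1r.
Qed.
Fact mul_cts f g : continuous (fun x => f x * g x).
Proof.
apply: mx_continuous => i j.
rewrite (_ : (fun x => _) = \sum_l (fun x => f x i l * g x l j)); last first.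
  by apply/funext => x; rewrite mxE fct_sumE.
apply: (big_ind (fun u : H -> C => continuous u)).
- exact: cst_continuous.
- by move=> u v cu cv x; apply: cvgD; [exact: cu | exact: cv].
- by move=> l _ x; apply: cvgM; exact: entry_continuous.
Qed.
Fact adj_cts f : continuous (fun x => (f x)^t*).
Proof.
apply: mx_continuous => i j.
rewrite (_ : (fun x => _) = Num.conj \o (fun x => f x j i)).
  move=> x; apply: continuous_comp; first exact: entry_continuous.
  move=> A /= /nbhs_ballP[e e0 sA]; apply/nbhs_ballP; exists e => //= z xz.
  by apply: sA; move: xz; rewrite /ball /= -rmorphB norm_conjC.
by apply/funext => x; rewrite !mxE.
Qed.

Definition mxcont_zero : MC :=
  (mkcts (@cst_cts 0) : continuousType H M).
Definition mxcont_one : MC :=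
  (mkcts (@cst_cts 1) : continuousType H M).
Definition mxcont_add f g : MC :=
  (mkcts (@add_cts f g) : continuousType H M).
Definition mxcont_opp f : MC :=
  (mkcts (@opp_cts f) : continuousType H M).
Definition mxcont_mul f g : MC :=
  (mkcts (@mul_cts f g) : continuousType H M).
Definition mxcont_scale (l : C) f : MC :=
  (mkcts (@scale_cts l f) : continuousType H M).
Definition mxcont_star f : MC :=
  (mkcts (@adj_cts f) : continuousType H M).

Fact mxcont_addA : associative mxcont_add.
Proof. by move=> f g h; apply: mxcontP => x; exact: addrA. Qed.
Fact mxcont_addC : commutative mxcont_add.
Proof. by move=> f g; apply: mxcontP => x; exact: addrC. Qed.
Fact mxcont_add0 : left_id mxcont_zero mxcont_add.
Proof. by move=> f; apply: mxcontP => x; exact: add0r. Qed.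
Fact mxcont_addN : left_inverse mxcont_zero mxcont_opp mxcont_add.
Proof. by move=> f; apply: mxcontP => x; exact: addNr. Qed.
HB.instance Definition _ := GRing.isZmodule.Build MC
  mxcont_addA mxcont_addC mxcont_add0 mxcont_addN.

Fact mxcont_mulA : associative mxcont_mul.
Proof. by move=> f g h; apply: mxcontP => x; exact: mulrA. Qed.
Fact mxcont_mul1l : left_id mxcont_one mxcont_mul.
Proof. by move=> f; apply: mxcontP => x; exact: mul1r. Qed.
Fact mxcont_mul1r : right_id mxcont_one mxcont_mul.
Proof. by move=> f; apply: mxcontP => x; exact: mulr1. Qed.
Fact mxcont_mulDl : left_distributive mxcont_mul mxcont_add.
Proof. by move=> f g h; apply: mxcontP => x; exact: mulrDl. Qed.
Fact mxcont_mulDr : right_distributive mxcont_mul mxcont_add.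
Proof. by move=> f g h; apply: mxcontP => x; exact: mulrDr. Qed.
HB.instance Definition _ := GRing.Zmodule_isPzRing.Build MC
  mxcont_mulA mxcont_mul1l mxcont_mul1r mxcont_mulDl mxcont_mulDr.
Fact mxcont_one_neq0 : 1 != 0 :> MC.
Proof.
apply/eqP => /continuousEP /(_ 1%g) /matrixP /(_ 0 0).
by rewrite !mxE => /eqP; rewrite oner_eq0.
Qed.
HB.instance Definition _ := GRing.PzSemiRing_isNonZero.Build MC mxcont_one_neq0.

Fact mxcont_scaleA a b f :
  mxcont_scale a (mxcont_scale b f) = mxcont_scale (a * b) f.
Proof. by apply: mxcontP => x; exact: scalerA. Qed.
Fact mxcont_scale1 : left_id 1 mxcont_scale.
Proof. by move=> f; apply: mxcontP => x; exact: scale1r. Qed.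
Fact mxcont_scaleDr : right_distributive mxcont_scale +%R.
Proof. by move=> a f g; apply: mxcontP => x; exact: scalerDr. Qed.
Fact mxcont_scaleDl f : {morph mxcont_scale^~ f : a b / a + b}.
Proof. by move=> a b; apply: mxcontP => x; exact: scalerDl. Qed.
HB.instance Definition _ := GRing.Zmodule_isLmodule.Build C MC
  mxcont_scaleA mxcont_scale1 mxcont_scaleDr mxcont_scaleDl.

Fact mxcont_scaleAl a f g : a *: (f * g) = (a *: f) * g.
Proof. by apply: mxcontP => x; exact: scalerAl. Qed.
HB.instance Definition _ := GRing.Lmodule_isLalgebra.Build C MC mxcont_scaleAl.
Fact mxcont_scaleAr a f g : a *: (f * g) = f * (a *: g).
Proof. by apply: mxcontP => x; exact: scalerAr. Qed.
HB.instance Definition _ := GRing.Lalgebra_isAlgebra.Build C MC mxcont_scaleAr.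

Fact mxcont_starK : involutive mxcont_star.
Proof. by move=> f; apply: mxcontP => x; exact: trmxCK. Qed.
Fact mxcont_starD : {morph mxcont_star : f g / f + g}.
Proof.
move=> f g; apply: mxcontP => x; apply/matrixP => i j.
by rewrite !mxE rmorphD.
Qed.
Fact mxcont_starM : {morph mxcont_star : f g / f * g >-> g * f}.
Proof.
move=> f g; apply: mxcontP => x.
transitivity ((f x *m g x)^t*) => //.
by rewrite trmx_mul map_mxM.
Qed.
Fact mxcont_starZ a f : mxcont_star (a *: f) = Num.conj a *: mxcont_star f.
Proof.
apply: mxcontP => x; apply/matrixP => i j.
by rewrite !mxE rmorphM.
Qed.
HB.instance Definition _ := Algebra_isStarAlgebra.Build R MC
  mxcont_starK mxcont_starD mxcont_starM mxcont_starZ.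

End MxCont.

Definition finitely_generated (Gamma : groupType) : Prop :=
  exists s : seq Gamma, forall P : set Gamma,
    (forall g, g \in s -> P g) -> P 1%g ->
    (forall g h, P g -> P h -> P (g * h)%g) -> (forall g, P g -> P (g^-1)%g) ->
    forall g, P g.

Definition unitary_representation (R : realType) (Gamma : groupType)
    (A : starAlgType R) (u : Gamma -> A) : Prop :=
  (forall g, star (u g) * u g = 1 /\ u g * star (u g) = 1) /\
  (forall g h, u (g * h)%g = u g * u h).

(* (A, u) is the full group C*-algebra C^*(Gamma): A is generated by the unitary
   representation u, and every unitary representation of Gamma in a unital
   C*-algebra factors through u. *)
Definition full_group_cstar (R : realType) (Gamma : groupType)
    (A : cstarAlgType R) (u : Gamma -> A) : Prop :=
  [/\ unitary_representation u,
      dense [set a : banach A | exists s : seq (R[i] * Gamma),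
                                  a = \sum_(p <- s) p.1 *: u p.2] &
      forall (B : cstarAlgType R) (v : Gamma -> B), unitary_representation v ->
        exists phi : {lrmorphism A -> B},
          (forall a, phi (star a) = star (phi a)) /\ (forall g, phi (u g) = v g)].

(* The Haar state of the dual of Gamma; it is unital since u 1 = 1. *)
Definition haar_integration (R : realType) (Gamma : groupType)
    (A : cstarAlgType R) (u : Gamma -> A) (tau : {scalar A}) : Prop :=
  (forall a, 0 <= tau (star a * a)) /\ (forall g, tau (u g) = (g == 1%g)%:R).

(* C(H, U_K) is the set of elements of M_K(C(H)) with unitary values, with the
   pointwise product as group law. *)
Definition morphism_to_CHU (R : realType) (Gamma : groupType)
    (H : topologicalGroupType) (k : nat) (rho : Gamma -> mxcont R H k) : Prop :=
  (forall g x, rho g x \is unitarymx) /\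
  (forall g h x, rho (g * h)%g x = rho g x *m rho h x).

Definition induced_model (R : realType) (Gamma : groupType)
    (A : cstarAlgType R) (u : Gamma -> A) (H : topologicalGroupType) (k : nat)
    (rho : Gamma -> mxcont R H k) (pi : {lrmorphism A -> mxcont R H k}) : Prop :=
  (forall a, pi (star a) = star (pi a)) /\ (forall g, pi (u g) = rho g).

Definition tr_int (R : realType) (H : topologicalGroupType) (k : nat)
    (mu : probability (borel H) R) (f : mxcont R H k) : R[i] :=
  cintegral mu (fun x => \tr (f x) / k.+1%:R).

Definition stationary (R : realType) (A : cstarAlgType R)
    (H : topologicalGroupType) (k : nat) (mu : probability (borel H) R)
    (tau : {scalar A}) (pi : {lrmorphism A -> mxcont R H k}) : Prop :=
  forall a, tau a = tr_int mu (pi a).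

Definition admits_traceless_model (R : realType) (Gamma : groupType) : Prop :=
  exists (H : compactLieGroupType R) (mu : probability (borel H) R) (k : nat)
    (rho : Gamma -> mxcont R H k),
    [/\ haar_probability mu, morphism_to_CHU rho, injective rho
      & forall g : Gamma, g != 1%g -> tr_int mu (rho g) = 0].

(* Main.v *)
Require Import Defs.
From HB Require Import structures.
From mathcomp Require Import all_boot all_order all_algebra complex.
From mathcomp Require Import all_classical all_reals all_analysis.
From mathcomp Require Import measurable_realfun.
From mathcomp Require Import ring lra.

Set Implicit Arguments.
Unset Strict Implicit.
Unset Printing Implicit Defensive.

Import Order.TTheory GRing.Theory Num.Theory.
Import numFieldNormedType.Exports.
Local Open Scope classical_set_scope.
Local Open Scope ring_scope.
Local Open Scope complex_scope.
Local Open Scope sesquilinear_scope.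

(* Stationarity: a functional [phi] with [phi (a^* a) >= 0] on a C*-algebra is
   bounded, because [1 - h] is of the form [b^* b] when [h] is self-adjoint of
   small norm.  The Haar state and [(tr \otimes \int_H) \circ pi] are both of this
   kind and agree on the group elements, whose span is dense.

   Existence: a finitely generated abelian group has a free subgroup Z^n of
   finite index, and the characters of the torus T^n = R^n / Z^n give an embedding
   a |-> (x |-> e^(2 i pi a.x)) of Z^n whose nontrivial elements have zero Haar
   integral.  The representation induced to the whole group is monomial: the
   diagonal entries at g are 0 or characters of conjugates of g, so the trace
   condition is inherited.  A finite group is the case of the trivial subgroup,
   with n = 0: the regular representation over the one-point torus. *)

(** * Positive functionals on C*-algebras *)

(** Neither [tau] nor [pi] comes with a norm bound, and [mxcont] carries no norm, so the boundedness
    of both functionals has to come from positivity alone. The square root behind it is produced by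
    a fixed-point iteration instead of functional calculus, which rests only on completeness and the
    C*-norm inequalities.

    Inducing from a subgroup of finite index, instead of splitting the group as Z^n times a torsion
    group, means that only a free subgroup has to be found: an element with no conjugate in that
    subgroup, such as a nontrivial torsion element, has zero diagonal. Faithfulness also comes from
    the trace condition, since the identity has trace 1.

    On the torus everything is reduced to lifts in R^n: two lifts of a point differ by an integer
    vector, and the group operations are linear on lifts. Haar measure is obtained by induction on
    the dimension, as an image of a product measure. The obstacle there is that Borel sets of the
    product must be measurable for the product sigma-algebra; second countability provides this. *)

Section PreCStar.
Variables (R : realType) (A : cstarAlgType R).
Implicit Types a b h y : A.

Lemma cnorm_ge0 a : 0 <= cnorm a.
Proof. exact: (normr_ge0 (a : banach A)). Qed.

Lemma cnorm0 : cnorm (0 : A) = 0.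
Proof. exact: (@normr0 _ (banach A)). Qed.

Lemma cnormN a : cnorm (- a) = cnorm a.
Proof. exact: (@normrN _ (banach A) a). Qed.

Lemma cnormBC a b : cnorm (a - b) = cnorm (b - a).
Proof. exact: (@distrC _ (banach A) a b). Qed.

Lemma cnormB a b c : cnorm (a - b) <= cnorm (a - c) + cnorm (c - b).
Proof. by apply: le_trans (cnormD _ _); rewrite addrA subrK. Qed.

(** The C*-identity and submultiplicativity bound the square of the norm of b by the norm of
    [star b] times that of b; cancel, then apply this to a and to [star a]. *)
Lemma cnorm_star a : cnorm (star a) = cnorm a.
Proof.
have le_star b : cnorm b <= cnorm (star b).
  have [->|b0] := eqVneq (cnorm b) 0; first exact: cnorm_ge0.
  have b_gt0 : 0 < cnorm b by rewrite lt_def b0 cnorm_ge0.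
  by rewrite -(ler_pM2r b_gt0) -expr2 -cnorm_star_mul cnormM.
by apply/eqP; rewrite eq_le le_star andbT -{2}[a]starK le_star.
Qed.

Lemma starN a : star (- a) = - star a.
Proof. by rewrite -scaleN1r starZ rmorphN1 scaleN1r. Qed.

Lemma star1 : star 1 = 1 :> A.
Proof. by rewrite -[RHS]starK -[X in _ = star X]mul1r starM !starK mul1r. Qed.

(** The splitting y (y - z) + (y - z) z avoids commuting y with z. With r = 1/2 squaring is
    1-Lipschitz on the ball, so half of it is a contraction. *)
Lemma cnormBsqr y z r : cnorm y <= r -> cnorm z <= r ->
  cnorm (y ^+ 2 - z ^+ 2) <= 2 * r * cnorm (y - z).
Proof.
move=> yr zr.
have -> : y ^+ 2 - z ^+ 2 = y * (y - z) + (y - z) * z.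
  by rewrite mulrBr mulrBl addrA subrK.
apply: le_trans (cnormD _ _) _.
rewrite [leRHS](_ : _ = r * cnorm (y - z) + r * cnorm (y - z)); last by ring.
apply: lerD.
  by apply: le_trans (cnormM _ _) _; rewrite ler_wpM2r ?cnorm_ge0.
by apply: le_trans (cnormM _ _) _; rewrite mulrC ler_wpM2r ?cnorm_ge0.
Qed.

Lemma geometric_cvg (y : nat -> A) :
  (forall n, cnorm (y n.+1 - y n) <= 2^-1 ^+ n) ->
  exists l, forall e : R[i], 0 < e ->
    \forall n \near \oo, cnorm (l - y n) < e.
Proof.
move=> dy.
have dist n m : (n <= m)%N -> cnorm (y m - y n) <= 2 * 2^-1 ^+ n.
  move=> /subnKC <-; set k := (m - n)%N.
  (* The extra factor 1 - 2^-k records the exact partial sum of the geometric series, so that the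
     induction closes with equality. *)
  suff : cnorm (y (n + k)%N - y n) <= 2 * 2^-1 ^+ n * (1 - 2^-1 ^+ k).
    move=> /le_trans; apply; rewrite ger_pMr ?mulr_gt0 ?exprn_gt0 ?invr_gt0 //.
  elim: k => [|k IH]; first by rewrite addn0 subrr cnorm0 expr0 subrr mulr0.
  apply: le_trans (cnormB _ _ (y (n + k)%N)) _.
  rewrite addnS; apply: le_trans (lerD (dy _) IH) _.
  rewrite exprD exprS le_eqVlt; apply/orP; left; apply/eqP.
  by field.
(* Positive elements of [R[i]] are real, so the limit of the real geometric sequence carries
   over. *)
have small (e : R[i]) : 0 < e -> \forall n \near \oo, 2 * 2^-1 ^+ n < e.
  move=> e0; have eR : e = (complex.Re e)%:C by rewrite RRe_real // gtr0_real.
  have re0 : 0 < complex.Re e by rewrite -ltcR -eR.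
  have : geometric 1 2^-1 @ \oo --> (0 : R).
    by apply: cvg_geometric; rewrite ger0_norm ?invr_ge0 // invf_lt1 // ltr1n.
  move=> /cvgrPdist_lt/(_ (complex.Re e / 2)).
  rewrite divr_gt0 // => /(_ isT)[N _ HN].
  exists N => // p /HN /=; rewrite sub0r normrN mul1r ger0_norm ?exprn_ge0 ?invr_ge0 //.
  rewrite ltr_pdivlMr // mulrC -ltcR -eR; congr (_ < _).
  by rewrite rmorphM rmorphXn fmorphV rmorph_nat.
have : cvg ((y : nat -> banach A) @ \oo).
  apply/cauchy_cvgP; apply/cauchy_ballP => e e0; near_simpl.
  have [N _ HN] := small e e0.
  exists ([set n | (N <= n)%N], [set n | (N <= n)%N]); first by split; exists N.
  move=> [n m] [/= Nn Nm]; rewrite -ball_normE /=.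
  have [nm|/ltnW mn] := leqP n m.
    rewrite -[`|_|]/(cnorm (y n - y m)) cnormBC.
    exact: le_lt_trans (dist _ _ nm) (HN _ Nn).
  exact: le_lt_trans (dist _ _ mn) (HN _ Nm).
move=> /cvg_ex[l /cvgrPdist_lt Hl]; exists l => e /Hl; exact.
Qed.

(* [1 - h] is the square of [1 - y], where [y] is the fixed point of the
   contraction [y |-> (h + y ^+ 2) / 2] of the ball of radius 1/2. *)
Lemma hermitian_sqrt h : star h = h -> cnorm h <= 2^-1 ->
  exists b, star b * b = 1 - h.
Proof.
move=> hh nh.
pose f y := 2^-1 *: (h + y ^+ 2) : A.
have half_gt0 : 0 < 2^-1 :> R[i] by rewrite invr_gt0.
have nhalf : `|2^-1 : R[i]| = 2^-1 by rewrite gtr0_norm.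
have fball y : cnorm y <= 2^-1 -> cnorm (f y) <= 2^-1.
  move=> ny; rewrite cnormZ nhalf ger_pMr //.
  apply: le_trans (cnormD _ _) _; rewrite -[leRHS](@divff _ 2%:R) // mulr2n mulrDl mul1r.
  apply: lerD => //; apply: le_trans (cnormM _ _) _.
  apply: (le_trans (ler_pM _ _ ny ny)); rewrite ?cnorm_ge0 // ger_pMr //.
  by rewrite invf_le1 // ler1n.
have fcontr y z : cnorm y <= 2^-1 -> cnorm z <= 2^-1 ->
    cnorm (f y - f z) <= 2^-1 * cnorm (y - z).
  move=> ny nz; rewrite /f -scalerBr opprD addrACA subrr add0r cnormZ nhalf ler_pM2l //.
  by apply: le_trans (cnormBsqr ny nz) _; rewrite divff // mul1r.
pose y n := iter n f 0.
have yball n : cnorm (y n) <= 2^-1.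
  by elim: n => [|n IH]; [rewrite cnorm0 ltW|exact: fball].
have [l Hl] : exists l, forall e : R[i], 0 < e ->
    \forall n \near \oo, cnorm (l - y n) < e.
  apply: geometric_cvg; elim=> [|n IH].
    rewrite expr0 [y 0%N]/(0 : A) subr0 (le_trans (yball 1%N)) //.
    by rewrite invf_le1 // ler1n.
  rewrite exprS; apply: le_trans (fcontr (y n.+1) (y n) (yball _) (yball _)) _.
  by rewrite ler_pM2l.
have lball : cnorm l <= 2^-1.
  apply/ler_addgt0Pl => e e0; near \oo => n.
  rewrite -[l](subrK (y n)); apply: le_trans (cnormD _ _) _.
  by rewrite lerD // ltW //; near: n; exact: Hl.
have eq_of_small (z t : A) : (forall e : R[i], 0 < e -> cnorm (z - t) <= 0 + e) -> z = t.
  move=> /ler_addgt0Pr small; apply/eqP; rewrite -subr_eq0; apply/eqP/cnorm0_eq0.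
  by apply/eqP; rewrite eq_le small cnorm_ge0.
have lfix : l = f l.
  apply: eq_of_small => e e0; near \oo => n; rewrite add0r.
  apply: le_trans (cnormB _ _ (y n.+1)) _.
  rewrite [leRHS]splitr lerD //.
    rewrite ltW //; near: n; have := Hl (e / 2).
    by rewrite divr_gt0 // => /(_ isT) [N _ HN]; exists N => // n /leqW; exact: HN.
  apply: le_trans (fcontr _ _ (yball n) lball) _; rewrite mulrC cnormBC.
  rewrite ler_pM2r // ltW //; near: n; exact: Hl.
(* Since h is self-adjoint, [star l] is also a fixed point of [f] in the ball, and a contraction has
   only one. *)
have starl : star l = l.
  apply: eq_of_small => e e0; rewrite add0r.
  have : cnorm (star l - l) <= 2^-1 * cnorm (star l - l).
    rewrite {1}lfix {2}lfix starZ starD starM hh.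
    have -> : Num.conj (2^-1 : R[i]) = 2^-1 by rewrite fmorphV rmorph_nat.
    by apply: fcontr => //; rewrite cnorm_star.
  rewrite -subr_le0 -{1}[cnorm _]mul1r -mulrBl.
  have -> : 1 - 2^-1 = 2^-1 :> R[i] by field.
  rewrite pmulr_rle0 // => le0; exact: le_trans le0 (ltW e0).
exists (1 - l).
rewrite starD star1 starN starl.
(* The fixed-point equation turns (1 - l)^2 = 1 - 2 l + l^2 into 1 - h. *)
have : 2 *: l = h + l ^+ 2 by rewrite {1}lfix scalerA divff // scale1r.
rewrite scaler_nat mulr2n => eql.
rewrite mulrBr mulr1 mulrBl mul1r -expr2.
have -> : l ^+ 2 = l + l - h by rewrite eql addrC addKr.
by rewrite -addrA -opprD addrA; congr (_ - _); rewrite opprB addrC subrK.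
Unshelve. all: by end_near. Qed.

(** For self-adjoint h of norm at most 1/2, both 1 - h and 1 + h have the form b^* b, so [phi h]
    lies between [- phi 1] and [phi 1]. The factor 4 arises because an element of norm at most 1/4
    has twice its real and imaginary parts of norm at most 1/2. *)
Lemma positive_functional_bounded (phi : A -> R[i]) :
  (forall a b, phi (a + b) = phi a + phi b) ->
  (forall l a, phi (l *: a) = l * phi a) ->
  (forall a, 0 <= phi (star a * a)) ->
  forall a, `|phi a| <= 4 * phi 1 * cnorm a.
Proof.
move=> phiD phiZ phi_ge0.
have phiN a : phi (- a) = - phi a by rewrite -scaleN1r phiZ mulN1r.
have herm h : star h = h -> cnorm h <= 2^-1 -> `|phi h| <= phi 1.
  move=> hh nh; have [b Hb] := hermitian_sqrt hh nh.
  have [||c Hc] := @hermitian_sqrt (- h); rewrite ?cnormN //.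
    by rewrite starN hh.
  have := phi_ge0 b; rewrite Hb phiD phiN => h1.
  have := phi_ge0 c; rewrite Hc opprK phiD => h2.
  (* The order of [R[i]] bounds a modulus this way only for real elements; reality is read off the
     two nonnegative values, whose sum is [2 * phi 1]. *)
  have r1 : phi 1 \is Num.real.
    have := rpredD (ger0_real h1) (ger0_real h2).
    rewrite addrACA addNr addr0 -mulr2n -mulr_natl.
    by rewrite realMr ?realn // pnatr_eq0.
  have rh : phi h \is Num.real.
    by rewrite -[phi h](addKr (phi 1)) rpredD ?rpredN // ger0_real.
  by apply/real_ler_normlP => //; split; rewrite -subr_ge0 ?opprK.
have small a : cnorm a <= 4^-1 -> `|phi a| <= phi 1.
  move=> na.
  have ci : Num.conj (- 'i%R : R[i]) = 'i%R by rewrite rmorphN /= conjCi opprK.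
  (* Both h and k are self-adjoint of norm at most 1/2, and 2 a = h + i k. *)
  pose h := a + star a; pose k := (- 'i%R) *: (a - star a) : A.
  have na2 : cnorm a + cnorm (star a) <= 2^-1.
    rewrite cnorm_star; apply: le_trans (lerD na na) _.
    by rewrite le_eqVlt; apply/orP; left; apply/eqP; field.
  have nh : `|phi h| <= phi 1.
    apply: herm; first by rewrite starD starK addrC.
    exact: le_trans (cnormD _ _) na2.
  have nk : `|phi k| <= phi 1.
    apply: herm.
      by rewrite /k starZ ci starD starN starK scaleNr -scalerN opprB.
    rewrite cnormZ normrN normCi mul1r; apply: le_trans (cnormD _ _) _.
    by rewrite cnormN.
  have e2 : a + a = h + 'i%R *: k.
    by rewrite scalerA mulrN -expr2 sqrCi opprK scale1r addrACA subrr addr0.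
  have : `|2 * phi a| <= 2 * phi 1.
    rewrite mulr_natl mulr2n -phiD e2 phiD phiZ mulr_natl mulr2n.
    apply: le_trans (ler_normD _ _) _.
    by rewrite normrM normCi mul1r lerD.
  by rewrite normrM normr_nat ler_pM2l.
move=> a; have [a0|a0] := eqVneq (cnorm a) 0.
  rewrite (cnorm0_eq0 _ a0) cnorm0 mulr0.
  by have -> : phi 0 = 0; rewrite ?normr0 // -(scale0r (0 : A)) phiZ mul0r.
have a_gt0 : 0 < cnorm a by rewrite lt_def a0 cnorm_ge0.
have := small ((4 * cnorm a)^-1 *: a).
have p4 : 0 < (4 * cnorm a)^-1 by rewrite invr_gt0 mulr_gt0.
rewrite cnormZ gtr0_norm //.
have -> : (4 * cnorm a)^-1 * cnorm a = 4^-1 by field.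
move=> /(_ (lexx _)); rewrite phiZ normrM gtr0_norm //.
by rewrite mulrC ler_pdivrMr ?mulr_gt0 // mulrCA mulrA.
Qed.
End PreCStar.

(** * Integration of continuous functions *)

Lemma normc_ge_Im (R : rcfType) (z : R[i]) : `|complex.Im z|%:C <= `|z|.
Proof.
by rewrite normc_def lecR -sqrtr_sqr ler_sqrt ?addr_ge0 ?sqr_ge0 // lerDr sqr_ge0.
Qed.

Section ComplexContinuity.
Variables (R : realType) (T : topologicalType).

Lemma continuous_ReIm (f : T -> R[i]) : continuous f ->
  continuous (fun x => complex.Re (f x)) /\ continuous (fun x => complex.Im (f x)).
Proof.
move=> cf; split=> x; apply/cvgrPdist_lt => e e0;
  have e0C : 0 < e%:C by rewrite ltcR.
- move/cvgrPdist_lt: (cf x) => /(_ _ e0C); apply: filterS => y.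
  move=> H; rewrite -ltcR; apply: le_lt_trans H.
  by rewrite -raddfB; apply: normc_ge_Re.
- move/cvgrPdist_lt: (cf x) => /(_ _ e0C); apply: filterS => y.
  move=> H; rewrite -ltcR; apply: le_lt_trans H.
  by rewrite -raddfB; apply: normc_ge_Im.
Qed.

Lemma continuous_complex (f g : T -> R) : continuous f -> continuous g ->
  continuous (fun x => f x +i* g x : R[i]).
Proof.
move=> cf cg x; apply/cvgrPdist_lt => e e0.
have eR : e = (complex.Re e)%:C by rewrite RRe_real // gtr0_real.
have re0 : 0 < complex.Re e / 2 by rewrite divr_gt0 // -ltcR -eR.
have := cf x; have := cg x.
move=> /cvgrPdist_lt/(_ _ re0) Hg /cvgrPdist_lt/(_ _ re0) Hf.
near=> y; rewrite eR.
have -> : f x +i* g x - (f y +i* g y) =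
    (f x - f y)%:C + 'i%C * (g x - g y)%:C :> R[i].
  by rewrite [RHS]/=; simpc.
apply: le_lt_trans (ler_normD _ _) _.
have normR (c : R) : `|c%:C| = `|c|%:C.
  by rewrite normc_def /= expr0n addr0 sqrtr_sqr.
have normi : `|'i%C : R[i]| = 1 by rewrite normc_def /= expr0n expr1n add0r sqrtr1.
rewrite normrM normi mul1r !normR -rmorphD ltcR.
rewrite [ltRHS]splitr ltrD //; near: y; [exact: Hf|exact: Hg].
Unshelve. all: by end_near. Qed.

End ComplexContinuity.

Section Integration.
Variables (R : realType) (H : topologicalGroupType).

Lemma open_borel (U : set H) : open U -> measurable (U : set (borel H)).
Proof. by move=> oU; exact: sub_sigma_algebra. Qed.

Lemma continuous_borel (f : H -> R) : continuous f ->
  measurable_fun setT (f : borel H -> R).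
Proof.
move=> /continuousP cf; apply: (measurability _ (measurable_realfun.RGenOpens.measurableE R)).
move=> _ [_ [a [b ->]] <-]; rewrite setTI; apply: open_borel.
exact/cf/interval_open.
Qed.

Hypothesis compH : compact [set: H].
Variable mu : probability (borel H) R.

Lemma continuous_integrable (f : H -> R) : continuous f ->
  mu.-integrable setT (EFin \o f : borel H -> \bar R).
Proof.
move=> cf; apply: measurable_bounded_integrable => //.
- by rewrite [X in (X < _)%E](@probability_setT _ _ _ mu) ltry.
- exact: continuous_borel.
have : compact [set f x | x in [set: H]].
  by apply: continuous_compact => //; exact: continuous_subspaceT.
move=> /compact_bounded; rewrite /bounded_near => -[M [Mr HM]].
by exists M; split => // x /HM xb y _; apply: xb; exists y.
Qed.

Lemma cintegralD (f g : H -> R[i]) : continuous f -> continuous g ->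
  cintegral mu (fun x => f x + g x) = cintegral mu f + cintegral mu g.
Proof.
move=> /continuous_ReIm[cf1 cf2] /continuous_ReIm[cg1 cg2]; rewrite /cintegral.
under eq_Rintegral do rewrite raddfD.
rewrite RintegralD //; try exact: continuous_integrable.
under [X in _ +i* X]eq_Rintegral do rewrite raddfD.
rewrite RintegralD //; exact: continuous_integrable.
Qed.

Lemma cintegralZ (l : R[i]) (f : H -> R[i]) : continuous f ->
  cintegral mu (fun x => l * f x) = l * cintegral mu f.
Proof.
move=> /continuous_ReIm[cf1 cf2]; rewrite /cintegral.
have mulE (z w : R[i]) : z * w =
    (complex.Re z * complex.Re w - complex.Im z * complex.Im w) +i*
    (complex.Re z * complex.Im w + complex.Im z * complex.Re w).
  by case: z w => a b [].
have Zint (c : R) (h : H -> R) : continuous h ->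
    mu.-integrable setT (EFin \o (fun x => c * h x) : borel H -> \bar R).
  by move=> ch; apply: continuous_integrable => x; apply: cvgM; [exact: cvg_cst|exact: ch].
under eq_Rintegral do rewrite mulE /=.
rewrite RintegralB //; try exact: Zint.
under [X in _ +i* X]eq_Rintegral do rewrite mulE /=.
rewrite RintegralD //; try exact: Zint.
rewrite !RintegralZl //; try exact: continuous_integrable.
Qed.

Lemma cintegral_ge0 (f : H -> R[i]) : (forall x, 0 <= f x) -> 0 <= cintegral mu f.
Proof.
move=> f0; have Im0 x : complex.Im (f x) = 0.
  by have := f0 x; rewrite lecE /= => /andP[/eqP].
rewrite /cintegral; under [X in _ +i* X]eq_Rintegral do rewrite Im0.
rewrite Rintegral_cst // mul0r.
rewrite lecE /= eqxx /=; apply: Rintegral_ge0 => x _.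
by have := f0 x; rewrite lecE /= => /andP[].
Qed.

Variable k : nat.
Local Notation MC := (mxcont R H k).

Lemma continuous_tr (f : MC) : continuous (fun x => \tr (f x) / k.+1%:R).
Proof.
suff ctr : continuous (fun x => \tr (f x)).
  by move=> x; apply: cvgM; [exact: ctr|exact: cvg_cst].
rewrite (_ : (fun x => _) = \sum_i (fun x => f x i i)); last first.
  by apply/funext => z; rewrite fct_sumE.
apply: (big_ind (fun u : H -> R[i] => continuous u)).
- exact: cst_continuous.
- by move=> u v cu cv x; apply: cvgD; [exact: cu | exact: cv].
- by move=> i _; exact: entry_continuous.
Qed.

Lemma tr_intD (f g : MC) : tr_int mu (f + g) = tr_int mu f + tr_int mu g.
Proof.
rewrite /tr_int -cintegralD; try exact: continuous_tr.
by congr cintegral; apply/funext => x; rewrite -mulrDl -mxtraceD.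
Qed.

Lemma tr_intZ (l : R[i]) (f : MC) : tr_int mu (l *: f) = l * tr_int mu f.
Proof.
rewrite /tr_int -cintegralZ; last exact: continuous_tr.
by congr cintegral; apply/funext => x; rewrite mulrA -mxtraceZ.
Qed.

(** Pointwise, the trace of f^* f is the sum of the squared moduli of the entries of f. *)
Lemma tr_int_ge0 (f : MC) : 0 <= tr_int mu (star f * f).
Proof.
apply: cintegral_ge0 => x; apply: divr_ge0 => //.
apply: sumr_ge0 => i _; rewrite mxE; apply: sumr_ge0 => j _.
by rewrite !mxE mulrC mul_conjC_ge0.
Qed.

Lemma tr_int1 : tr_int mu (1 : MC) = 1.
Proof.
rewrite /tr_int /cintegral.
under eq_Rintegral => x _ do rewrite mxtrace1 divff ?pnatr_eq0 //=.
under [X in _ +i* X]eq_Rintegral => x _ do rewrite mxtrace1 divff ?pnatr_eq0 //=.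
rewrite !Rintegral_cst //. by rewrite [X in fine X](@probability_setT _ _ _ mu) /= mul1r mul0r.
Qed.

End Integration.

(** * Stationarity of traceless models *)

Lemma stationary_of_traceless (R : realType) (Gamma : groupType)
    (H : topologicalGroupType) (mu : probability (borel H) R) (k : nat)
    (rho : Gamma -> mxcont R H k) (A : cstarAlgType R) (u : Gamma -> A)
    (tau : {scalar A}) (pi : {lrmorphism A -> mxcont R H k}) :
  compact [set: H] ->
  full_group_cstar u -> haar_integration u tau -> induced_model u rho pi ->
  (forall g : Gamma, g != 1%g -> tr_int mu (rho g) = 0) ->
  stationary mu tau pi.
Proof.
move=> compH [[uu uM] udense _] [tau_ge0 tauE] [pistar piE] trrho.
(* An invertible idempotent is 1. *)
have u1 : u 1%g = 1.
  have [uu1 _] := uu 1%g.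
  by rewrite -[LHS]mul1r -uu1 -mulrA -uM mulg1.
pose s a := tr_int mu (pi a).
have sD a b : s (a + b) = s a + s b by rewrite /s raddfD tr_intD.
have sZ l a : s (l *: a) = l * s a by rewrite /s linearZ tr_intZ.
have s_ge0 a : 0 <= s (star a * a) by rewrite /s rmorphM /= pistar tr_int_ge0.
have s1 : s 1 = 1 by rewrite /s rmorph1 tr_int1.
have tau1 : tau 1 = 1 by rewrite -u1 tauE eqxx.
have taub := positive_functional_bounded (linearD tau) (linearZ_LR tau) tau_ge0.
have sb := positive_functional_bounded sD sZ s_ge0.
have sum_eq (r : seq (R[i] * Gamma)) :
    tau (\sum_(p <- r) p.1 *: u p.2) = s (\sum_(p <- r) p.1 *: u p.2).
  have s0 : s 0 = 0 by rewrite -(scale0r (0 : A)) sZ mul0r.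
  elim: r => [|[l g] r IH]; first by rewrite !big_nil linear0 s0.
  rewrite !big_cons linearD sD IH linearZ sZ /= tauE; congr (l * _ + _).
  rewrite /s piE; have [->|g1] := eqVneq g 1%g; last by rewrite trrho.
  by rewrite -piE u1 -/(s 1) s1.
move=> a; apply/eqP; rewrite -subr_eq0 -normr_le0; apply/ler_addgt0Pl => e e0.
rewrite addr0.
(* Each of [tau] and [s] takes the value 1 at 1, so each contributes at most 4 times the norm of a -
   b. *)
have e8 : 0 < e / 8 by rewrite divr_gt0.
have [||b [/interior_subset ab [r br]]] := udense (ball (a : banach A) (e / 8))°.
- by exists a; apply: nbhsx_ballx.
- exact: open_interior.
have -> : tau a - s a = tau (a - b) - s (a - b).
  rewrite linearB sD -[- b]scaleN1r sZ mulN1r br sum_eq.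
  by rewrite opprD addrACA subrr addr0.
apply: le_trans (ler_normB _ _) _; apply: le_trans (lerD (taub _) (sb _)) _.
rewrite tau1 s1 mulr1 -mulrDl.
move: ab; rewrite -ball_normE /= -[`|_|]/(cnorm (a - b)) ltr_pdivlMr // => /ltW.
by rewrite mulrC; congr (_ * _ <= _); rewrite -natrD.
Qed.

(** * The torus as a topological group *)

Definition frac (R : archiRealDomainType) (x : R) : R := x - (Num.floor x)%:~R.

Lemma frac_itv (R : archiRealDomainType) (x : R) : 0 <= frac x < 1.
Proof.
by have := floor_itv x; rewrite subr_ge0 ltrBlDl intrD => /andP[-> /=].
Qed.

Lemma frac_id (R : archiRealDomainType) (x : R) : 0 <= x < 1 -> frac x = x.
Proof. by move=> x01; rewrite /frac (@floor_def _ _ 0) ?subr0 ?add0r. Qed.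

Lemma fracDz (R : archiRealDomainType) (x : R) (m : int) : frac (x + m%:~R) = frac x.
Proof.
by rewrite /frac floorDrz ?intr_int // intrKfloor intrD opprD addrACA subrr addr0.
Qed.

(* The carrier is the fundamental domain [0, 1[^n of Z^n, but the topology given
   below is that of the quotient R^n / Z^n, not that of a subset of R^n. *)
Record torus (R : realType) (n : nat) := Torus {
  torus_val :> 'rV[R]_n;
  _ : [forall i, 0 <= torus_val 0 i < 1]
}.

HB.instance Definition _ (R : realType) n := [isSub for @torus_val R n].
HB.instance Definition _ (R : realType) n := [Choice of torus R n by <:].

Section Torus.
Variables (R : realType) (n : nat).
Local Notation V := 'rV[R]_n.
Local Notation T := (torus R n).
Local Notation int_vec m := (map_mx intr (m : 'rV[int]_n) : V).

Fact tproj_subproof (v : V) : [forall i, 0 <= (\row_i frac (v 0 i)) 0 i < 1].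
Proof. by apply/forallP => i; rewrite mxE frac_itv. Qed.

Definition tproj (v : V) : T := Torus (tproj_subproof v).

Lemma torus_itv (p : T) i : 0 <= p 0 i < 1.
Proof. by case: p => v /= /forallP. Qed.

Lemma tproj_val (p : T) : tproj p = p.
Proof.
by apply/val_inj/rowP => i; rewrite mxE frac_id // torus_itv.
Qed.

Lemma tproj_addz (v : V) (m : 'rV[int]_n) : tproj (v + int_vec m) = tproj v.
Proof. by apply/val_inj/rowP => i; rewrite !mxE fracDz. Qed.

Lemma val_tproj (v : V) : exists m : 'rV[int]_n, v = (tproj v : V) + int_vec m.
Proof.
exists (\row_i Num.floor (v 0 i)); apply/rowP => i.
by rewrite !mxE subrK.
Qed.

Lemma tproj_eq (v w : V) : tproj v = tproj w -> exists m, v = w + int_vec m.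
Proof.
move=> vw; have [a va] := val_tproj v; have [b wb] := val_tproj w.
have wE : (tproj w : V) = w - int_vec b by rewrite {2}wb addrK.
by exists (a - b); rewrite va vw wE map_mxB -addrA [- _ + _]addrC.
Qed.

Lemma tprojDl (v w : V) : tproj ((tproj v : V) + w) = tproj (v + w).
Proof. by have [m {2}->] := val_tproj v; rewrite addrAC tproj_addz. Qed.

Lemma tprojDr (v w : V) : tproj (v + (tproj w : V)) = tproj (v + w).
Proof. by rewrite addrC tprojDl addrC. Qed.

Lemma tprojN (v : V) : tproj (- (tproj v : V)) = tproj (- v).
Proof.
have [m vm] := val_tproj v.
by rewrite {2}vm opprD -map_mxN tproj_addz.
Qed.

Definition torus_mul (p q : T) : T := tproj ((p : V) + (q : V)).
Definition torus_one : T := tproj 0.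
Definition torus_inv (p : T) : T := tproj (- (p : V)).

Fact torus_mulA : associative torus_mul.
Proof. by move=> p q r; rewrite /torus_mul tprojDl tprojDr addrA. Qed.
Fact torus_mul1g : left_id torus_one torus_mul.
Proof. by move=> p; rewrite /torus_mul tprojDl add0r tproj_val. Qed.
Fact torus_mulg1 : right_id torus_one torus_mul.
Proof. by move=> p; rewrite /torus_mul tprojDr addr0 tproj_val. Qed.
Fact torus_mulVg : left_inverse torus_one torus_inv torus_mul.
Proof. by move=> p; rewrite /torus_mul tprojDl addNr. Qed.
Fact torus_mulgV : right_inverse torus_one torus_inv torus_mul.
Proof. by move=> p; rewrite /torus_mul tprojDr addrN. Qed.

HB.instance Definition _ := isGroup.Build T
  torus_mulA torus_mul1g torus_mulg1 torus_mulVg torus_mulgV.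

Lemma tprojD (v w : V) : tproj (v + w) = (tproj v * tproj w)%g.
Proof. by rewrite -tprojDl -tprojDr. Qed.

Lemma tprojV (v : V) : tproj (- v) = (tproj v)^-1%g.
Proof. by rewrite -tprojN. Qed.

(** The quotient topology, tested only at the lift of p in the fundamental domain; [nbhs_tproj]
    shows that every other lift gives the same neighbourhoods. *)
Definition torus_nbhs (p : T) : set_system T := [set A | nbhs (p : V) (tproj @^-1` A)].

HB.instance Definition _ := hasNbhs.Build T torus_nbhs.

(** The preimage of A is invariant under integer translations, and these are continuous. *)
Lemma nbhs_tproj (v : V) (A : set T) : nbhs (tproj v) A <-> nbhs v (tproj @^-1` A).
Proof.
have shift (x : V) (m : 'rV[int]_n) :
    nbhs (x + int_vec m) (tproj @^-1` A) -> nbhs x (tproj @^-1` A).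
  move=> xA.
  have cadd : {for x, continuous (fun y : V => y + int_vec m)}.
    by apply: (@continuousD _ _ _ idfun (cst (int_vec m))); [move=> B|exact: cst_continuous].
  by apply: (@filterS _ (nbhs x)) (cadd _ xA) => y /=; rewrite tproj_addz.
have [m vE] := val_tproj v; split.
  rewrite -[nbhs (tproj v) A]/(nbhs (tproj v : V) _) => H; apply: (shift _ (- m)).
  by rewrite {1}vE map_mxN addrK.
by rewrite {1}vE => /shift.
Qed.

Fact torus_nbhs_filter (p : T) : ProperFilter (nbhs p).
Proof.
by apply: Build_ProperFilter_ex => A /nbhs_singleton Ap; exists (tproj p).
Qed.
Fact torus_nbhs_singleton (p : T) (A : set T) : nbhs p A -> A p.
Proof. by move=> /nbhs_singleton; rewrite /= tproj_val. Qed.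
Fact torus_nbhs_nbhs (p : T) (A : set T) : nbhs p A -> nbhs p (nbhs^~ A).
Proof.
move=> /nbhs_interior pA; apply: (@filterS _ (nbhs (p : V))) pA => v vA.
exact/nbhs_tproj.
Qed.

HB.instance Definition _ := Nbhs_isNbhsTopological.Build T
  torus_nbhs_filter torus_nbhs_singleton torus_nbhs_nbhs.

Lemma tproj_continuous : continuous tproj.
Proof. by move=> v A /nbhs_tproj. Qed.

Lemma nbhs_image_tproj (v : V) (B : set V) : nbhs v B -> nbhs (tproj v) (tproj @` B).
Proof. by move=> vB; apply/nbhs_tproj; apply: filterS vB => y By; exists y. Qed.

Lemma tproj_open (U : set V) : open U -> open (tproj @` U).
Proof.
rewrite !openE => oU _ [v Uv <-]; apply: nbhs_image_tproj; exact: oU.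
Qed.

(** The universal property of the quotient. *)
Lemma continuous_torus (X : topologicalType) (f : T -> X) :
  continuous (f \o tproj) -> continuous f.
Proof.
by move=> cf p A; rewrite -{1}[p]tproj_val => /cf.
Qed.

Fact torus_mul_continuous : continuous (fun p : T * T => (p.1 * p.2)%g).
Proof.
move=> [p q] A /nbhs_tproj pqA.
have [[B1 B2] [/= pB1 qB2] B12] := @add_continuous V (p : V, q : V) _ pqA.
exists (tproj @` B1, tproj @` B2).
  by split=> /=; [rewrite -[p]tproj_val|rewrite -[q]tproj_val]; exact: nbhs_image_tproj.
move=> [_ _] [/= [x B1x <-] [y B2y <-]]; rewrite -tprojD.
exact: (B12 (x, y)).
Qed.
Fact torus_inv_continuous : continuous (fun p : T => p^-1%g).
Proof.
apply: continuous_torus => v.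
rewrite (_ : _ \o _ = tproj \o -%R); last by apply/funext => x; rewrite /= tprojV.
by apply: continuous_comp; [exact: opp_continuous|exact: tproj_continuous].
Qed.

HB.instance Definition _ := isTopologicalGroup.Build T
  torus_mul_continuous torus_inv_continuous.

Lemma rV_ballP (x : V) (e : R) (y : V) : 0 < e ->
  ball x e y <-> forall i, `|x 0 i - y 0 i| < e.
Proof.
move=> e0; split; first by move=> [_ H] i; exact: H.
by move=> H; split=> // i j; rewrite ord1; exact: H.
Qed.

Lemma torus_hausdorff : hausdorff_space T.
Proof.
move=> p q clpq; apply: contrapT => /eqP pq.
have [i pqi] : exists i, p 0 i != q 0 i.
  apply/existsP; rewrite -negb_forall; apply: contra pq => /forallP H.
  by apply/eqP/val_inj/rowP => i; apply/eqP.
have /andP[p0 p1] := torus_itv p i; have /andP[q0 q1] := torus_itv q i.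
pose d := `|p 0 i - q 0 i|.
have d0 : 0 < d by rewrite normr_gt0 subr_eq0.
have d1 : d < 1 by rewrite ltr_norml; apply/andP; split; lra.
(* The minimum is the distance of the two coordinates on the circle. A common point of the two
   images would give an integer m with |p_i - q_i + m| < 2 e, which d excludes for m = 0 and 1 - d
   for all other m. *)
pose e := Num.min d (1 - d) / 2.
have e0 : 0 < e by rewrite divr_gt0 // lt_min d0 subr_gt0.
have ed : 2 * e <= d by rewrite mulrC divfK // ge_min lexx.
have ed1 : 2 * e <= 1 - d by rewrite mulrC divfK // ge_min lexx orbT.
have [_ [[y /(rV_ballP _ _ e0)/(_ i) py <-] [z /(rV_ballP _ _ e0)/(_ i) qz]]] := clpq
  (tproj @` ball (p : V) e) (tproj @` ball (q : V) e)
  ltac:(by rewrite -{1}[p]tproj_val; apply/nbhs_image_tproj/nbhsx_ballx)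
  ltac:(by rewrite -{1}[q]tproj_val; apply/nbhs_image_tproj/nbhsx_ballx).
move=> /tproj_eq[m /rowP/(_ i)]; rewrite !mxE => zy.
have : `|(p 0 i - q 0 i) + (m 0 i)%:~R| < 2 * e.
  have -> : (p 0 i - q 0 i) + (m 0 i)%:~R = (p 0 i - y 0 i) - (q 0 i - z 0 i).
    by rewrite zy; ring.
  by apply: le_lt_trans (ler_normB _ _) _; rewrite mulr_natl mulr2n ltrD.
have [m0|m0] := eqVneq (m 0 i) 0.
  by rewrite m0 addr0 => /lt_le_trans/(_ ed); rewrite ltxx.
have m1 : 1 <= `|(m 0 i)%:~R : R|.
  by rewrite -intr_norm (ler1z _ `|m 0 i|) -gtz0_ge1 normr_gt0.
move=> /lt_le_trans/(_ ed1) lt1.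
have := lerB_normD (m 0 i)%:~R (p 0 i - q 0 i).
rewrite [_%:~R + _]addrC -/d; lra.
Qed.

Lemma rat_dense (v : V) (e : R) : 0 < e ->
  exists q : 'rV[rat]_n, ball v e (map_mx ratr q).
Proof.
move=> e0.
have /choice[q Hq] : forall i, exists q : rat, `|v 0 i - ratr q| < e.
  move=> i; have [|q] := @rat_in_itvoo R (v 0 i - e) (v 0 i + e); first lra.
  by rewrite in_itv /= => Hq; exists q; rewrite distrC ltr_distl.
by exists (\row_i q i); apply/rV_ballP => // i; rewrite !mxE.
Qed.

Lemma rV_basis : exists2 B : set (set V), countable B & basis B.
Proof.
pose b (qk : 'rV[rat]_n * nat) : set V :=
  ball (map_mx ratr qk.1 : V) (qk.2.+1%:R^-1).
exists (range b); first exact: card_le_trans (card_image_le _ _) (countableP _).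
split=> [_ [[q k] _ <-]|v A]; first exact: ball_open.
move=> /nbhs_ballP[e /= e0 vA].
(* With this k two radii 1/(k+1) add up to at most e, so a rational ball of that radius containing v
   stays inside the e-ball around v. *)
pose k := Num.trunc (2 / e).
have k0 : 0 < k.+1%:R^-1 :> R by rewrite invr_gt0.
have ke : k.+1%:R^-1 + k.+1%:R^-1 <= e.
  rewrite [leLHS](_ : _ = 2 / k.+1%:R); last by ring.
  rewrite ler_pdivrMr // mulrC -ler_pdivrMr // ltW //.
  exact: truncnS_gt.
have [q vq] := rat_dense v k0.
exists (b (q, k)).
  by split; [exists (q, k)|exact: ball_sym].
move=> w qw; apply: vA; apply: le_ball ke _ _; exact: ball_triangle vq qw.
Qed.

Lemma torus_second_countable : @second_countable T.
Proof.
have [B cB [oB bB]] := rV_basis.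
exists [set tproj @` U | U in B]; first exact: card_le_trans (card_image_le _ _) cB.
split=> [_ [U BU <-]|p A pA]; first exact/tproj_open/oB.
have [U [BU Up] UA] := bB (p : V) _ pA.
exists (tproj @` U); last by move=> _ [v Uv <-]; exact: UA.
by split; [exists U|exists (p : V); rewrite ?tproj_val].
Qed.

Lemma torus_compact : compact [set: T].
Proof.
have -> : [set: T] = tproj @` [set v : V | forall i, `[0, 1]%classic (v ord0 i)].
  apply/seteqP; split=> // p _; exists (p : V); last exact: tproj_val.
  move=> i /=; rewrite in_itv /=; have /andP[-> /ltW] := torus_itv p i; exact.
apply: continuous_compact; first exact/continuous_subspaceT/tproj_continuous.
by apply: (@rV_compact R n (fun=> `[0, 1]%classic)) => i; exact: segment_compact.
Qed.


End Torus.

(** * The torus as a Lie group *)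

Lemma rV_continuous (R : realType) (X : topologicalType) (n : nat) (f : X -> 'rV[R]_n) :
  (forall i, continuous (fun x => f x 0 i)) -> continuous f.
Proof.
move=> cf x A /= [P xP sPA].
suff : \forall y \near x, forall i j, P i j (f y i j) by apply: filterS => y /sPA.
apply: filter_forall => i; apply: filter_forall => j; rewrite ord1.
by apply: (cf j x); have := xP i j; rewrite ord1.
Qed.

Lemma locally_affine_continuous (R : realType) (n m : nat)
    (L f : 'rV[R]_n -> 'rV[R]_m) (x : 'rV[R]_n) : continuous L ->
  (exists c, \forall y \near x, f y = L y + c) -> {for x, continuous f}.
Proof.
move=> cL [c fc].
have cLc : {for x, continuous (fun y => L y + c)}.
  by apply: (@continuousD _ _ _ L (cst c)); [exact: cL|exact: cst_continuous].
rewrite /prop_for /continuous_at (nbhs_singleton fc) => A /cLc LA.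
by apply: (@filterS2 _ (nbhs x) _ _ _ _ _ fc LA) => y /= ->.
Qed.

(** The partial derivatives of such an f are constant on U, hence again locally affine, with linear
    part 0. Letting [L] vary in the induction on r is therefore enough. *)
Lemma Cr_on_locally_affine (R : realType) (n m r : nat) (U : set 'rV[R]_n)
    (L : {linear 'rV[R]_n -> 'rV[R]_m}) (f : 'rV[R]_n -> 'rV[R]_m) :
  open U -> continuous L ->
  (forall x, U x -> exists c, \forall y \near x, f y = L y + c) ->
  Cr_on r U f.
Proof.
elim: r L f => [|r IH] L f oU cL fE.
  by split=> // x Ux; apply: (locally_affine_continuous cL (fE x Ux)).
split=> [x Ux|]; first exact: (locally_affine_continuous cL (fE x Ux)).
move=> j; set v := delta_mx 0 j.
have dcvg x : U x -> h^-1 *: ((f \o shift x) (h *: v) - f x) @[h --> 0^'] --> L v.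
  move=> Ux; have [c fc] := fE x Ux.
  apply: cvg_near_cst.
  have : (h *: v + x) @[h --> (0 : R)] --> x.
    have := @cvgD _ _ _ (nbhs (0 : R)) _ _ _ _ _ (@scalel_continuous _ _ v (0 : R)) (cvg_cst x).
    by rewrite scale0r add0r; exact.
  move=> /(_ _ fc) fc'.
  near=> h.
  rewrite /= (nbhs_singleton fc) (_ : f (h *: v + x) = L (h *: v + x) + c).
    rewrite opprD addrACA subrr addr0 -linearB addrK linearZ_LR scalerA mulVf ?scale1r //.
    near: h; exact: nbhs_dnbhs_neq.
  near: h; exact: (nbhs_dnbhs fc').
split=> [x Ux|]; first by apply/cvg_ex; exists (L v); exact: dcvg.
apply: (IH \0%R) => // [|x Ux]; first exact: cst_continuous.
exists (L v); apply: filterS (open_nbhs_nbhs (conj oU Ux)) => y Uy.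
by rewrite add0r; apply: cvg_lim; [exact: norm_hausdorff|exact: dcvg].
Unshelve. all: by end_near. Qed.

Section TorusLie.
Variables (R : realType) (n : nat).
Local Notation V := 'rV[R]_n.
Local Notation T := (torus R n).
Local Notation int_vec m := (map_mx intr (m : 'rV[int]_n) : V).

Let half_gt0 : 0 < 2^-1 :> R.
Proof. by rewrite invr_gt0. Qed.

(** The lift of p whose coordinates lie in [c_i - 1/2, c_i + 1/2[. *)
Definition torus_chart_map (c : V) (p : T) : V :=
  \row_i (p 0 i - (Num.floor (p 0 i - c 0 i + 2^-1))%:~R).

(** Balls are open cubes here, and 1/2 is the largest radius for which [tproj] is injective on them
    in positive dimension. *)
Definition torus_chart (c : V) : chart R T n :=
  Chart (@tproj R n @` ball c 2^-1) (torus_chart_map c) (@tproj R n).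

Definition torus_atlas : set (chart R T n) := range torus_chart.

Lemma torus_chart_map_proj (c v : V) : ball c 2^-1 v ->
  torus_chart_map c (tproj v) = v.
Proof.
move=> /(rV_ballP _ _ half_gt0) cv; have [m vE] := val_tproj v.
apply/rowP => i; have vi : v 0 i = tproj v 0 i + (m 0 i)%:~R by rewrite {1}vE !mxE.
rewrite mxE (@floor_def _ _ (- m 0 i)); first by rewrite vi intrN opprK.
have := cv i; rewrite distrC ltr_distl => /andP[h1 h2].
by rewrite !intrD intrN; apply/andP; split; lra.
Qed.

Lemma torus_chart_cod (c : V) : chart_cod (torus_chart c) = ball c 2^-1.
Proof.
apply/seteqP; split=> [_ [_ [v cv <-] <-]|v cv] /=.
  by rewrite torus_chart_map_proj.
by exists (tproj v); [exists v|exact: torus_chart_map_proj].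
Qed.

Lemma torus_is_chart (c : V) : is_chart (torus_chart c).
Proof.
split.
- by apply: tproj_open; exact: ball_open.
- by rewrite torus_chart_cod; exact: ball_open.
- by move=> _ [v cv <-]; rewrite /= torus_chart_map_proj.
- move=> _ [v cv <-] A /=; rewrite torus_chart_map_proj // => vA.
  apply/nbhs_tproj; have := open_nbhs_nbhs (conj (ball_open c 2^-1) cv).
  move: vA; apply: filterS2 => y Ay cy /=.
  by rewrite torus_chart_map_proj.
- by move=> y _; exact: tproj_continuous.
Qed.

(* Group operations lift to affine maps of R^n, and two lifts of the same
   element differ by an integer vector; hence all maps read in charts are
   locally affine. *)
Lemma torus_smooth (N : nat) (U : set 'rV[R]_N) (L : {linear 'rV[R]_N -> V}) (c : V) :
  open U -> continuous L ->
  (forall x, U x -> (@tproj R n @` ball c 2^-1) (tproj (L x))) ->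
  smooth_on U (fun x => torus_chart_map c (tproj (L x))).
Proof.
move=> oU cL UL r; apply: (@Cr_on_locally_affine R N n r U L) => // x Ux.
have [w cw /tproj_eq[m wE]] := UL x Ux.
exists (int_vec m).
have cLm : {for x, continuous (fun y => L y + int_vec m)}.
  by apply: (@continuousD _ _ _ L (cst _)); [exact: cL|exact: cst_continuous].
have : nbhs (L x + int_vec m) (ball c 2^-1).
  by rewrite -wE; apply: open_nbhs_nbhs; split=> //; exact: ball_open.
move=> /cLm cB; apply: (@filterS _ (nbhs x)) cB => y /= cy.
by rewrite -(tproj_addz _ m) torus_chart_map_proj.
Qed.

Lemma open_chart_dom (N : nat) (L : 'rV[R]_N -> V) (c : V) : continuous L ->
  open [set x | (@tproj R n @` ball c 2^-1) (tproj (L x))].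
Proof.
move=> cL; apply: (@open_comp _ _ (@tproj R n \o L)); last by apply: tproj_open; exact: ball_open.
by move=> x _; apply: continuous_comp; [exact: cL|exact: tproj_continuous].
Qed.

Lemma open_chart_cod (N : nat) (L : 'rV[R]_N -> V) (c : V) : continuous L ->
  open [set x | chart_cod (torus_chart c) (L x)].
Proof.
move=> cL; rewrite torus_chart_cod.
by apply: open_comp; [move=> x _; exact: cL|exact: ball_open].
Qed.

Fact torus_smooth_atlas : smooth_atlas torus_atlas.
Proof.
split=> [_ [c _ <-]|p|_ _ [c _ <-] [d _ <-]]; first exact: torus_is_chart.
  exists (torus_chart p); first by exists (p : V).
  by exists (p : V); [exact: ballxx|exact: tproj_val].
apply: (torus_smooth (L := idfun)) => [||x [_]//]; last by move=> x.
by apply: openI; [apply: open_chart_cod|apply: open_chart_dom] => x.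
Qed.

Lemma lsubmx_continuous : continuous (@lsubmx R 1 n n).
Proof.
apply: rV_continuous => i; under eq_fun do rewrite mxE.
exact: coord_continuous.
Qed.

Lemma rsubmx_continuous : continuous (@rsubmx R 1 n n).
Proof.
apply: rV_continuous => i; under eq_fun do rewrite mxE.
exact: coord_continuous.
Qed.

Fact torus_smooth_mul : smooth_map2 torus_atlas (fun x y : T => (x * y)%g).
Proof.
move=> _ _ _ [c _ <-] [d _ <-] [e _ <-] /=.
pose L : {linear 'rV[R]_(n + n) -> V} := (@lsubmx R 1 n n \+ @rsubmx R 1 n n)%R.
have cL : continuous L.
  move=> x; apply: (@continuousD _ _ _ (@lsubmx R 1 n n) (@rsubmx R 1 n n)).
    exact: lsubmx_continuous.
  exact: rsubmx_continuous.
under [X in smooth_on _ X]eq_fun do rewrite -tprojD.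
apply: (torus_smooth (L := L)) => // [|x [_ _]]; last by rewrite -tprojD.
under eq_set do rewrite -tprojD.
rewrite (_ : mkset _ = [set z | chart_cod (torus_chart c) (lsubmx z)] `&`
  [set z | chart_cod (torus_chart d) (rsubmx z)] `&`
  [set z | (@tproj R n @` ball e 2^-1) (tproj (L z))]); last first.
  by apply/seteqP; split=> z /= [] // [].
apply: openI; last exact: open_chart_dom.
by apply: openI; apply: open_chart_cod; [exact: lsubmx_continuous|exact: rsubmx_continuous].
Qed.

Fact torus_smooth_inv : smooth_map1 torus_atlas (fun x : T => x^-1%g).
Proof.
move=> _ _ [c _ <-] [d _ <-] /=.
under [X in smooth_on _ X]eq_fun do rewrite -tprojV.
apply: (torus_smooth (L := \- idfun)) => [||x [_]]; last by rewrite -tprojV.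
  under eq_set do rewrite -tprojV.
  apply: openI; first by apply: open_chart_cod => x.
  apply: open_chart_dom; exact: opp_continuous.
exact: opp_continuous.
Qed.

HB.instance Definition _ := isLieGroup.Build R T
  (@torus_hausdorff R n) (@torus_second_countable R n)
  torus_smooth_atlas torus_smooth_mul torus_smooth_inv.

HB.instance Definition _ := isCompactGroup.Build T (@torus_compact R n).

End TorusLie.

(** * Haar measure on the torus *)

Lemma image_measure d1 d2 (T1 : measurableType d1) (T2 : measurableType d2)
    (R : realType) (P : {measure set T1 -> \bar R}) (f : T1 -> T2) :
  measurable_fun setT f ->
  exists Q : {measure set T2 -> \bar R}, forall A, Q A = P (f @^-1` A).
Proof.
move=> mf.
by exists (measure_function_pushforward__canonical__measure_function_Measure P mf).
Qed.

Lemma image_probability d1 d2 (T1 : measurableType d1) (T2 : measurableType d2)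
    (R : realType) (P : probability T1 R) (f : T1 -> T2) : measurable_fun setT f ->
  exists Q : probability T2 R, forall A, Q A = P (f @^-1` A).
Proof.
move=> mf; pose X : {mfun T1 >-> T2} := HB.pack f (isMeasurableFun.Build _ _ _ _ f mf).
by exists (distribution P X).
Qed.

Lemma measurable_shift (R : realType) (a : R) :
  measurable_fun setT (fun x : measurableTypeR R => x + a : measurableTypeR R).
Proof. by apply: measurable_funD => //; exact: measurable_cst. Qed.

(** The image of Lebesgue measure under the shift agrees with it on intervals ]x, y], which
    determine it. *)
Lemma lebesgue_measure_shift (R : realType) (a : R) (A : set R) :
  measurable (A : set (measurableTypeR R)) ->
  lebesgue_measure [set x | A (x + a)] = lebesgue_measure A.
Proof.
move=> mA.
have [Q QE] := image_measure (@lebesgue_measure R) (measurable_shift a).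
transitivity (Q A); first by rewrite QE.
apply/esym/lebesgue_measure_unique => // _ [[x y] _ <-] /=.
rewrite QE (_ : _ @^-1` _ = `]x - a, y - a]%classic); last first.
  by apply/seteqP; split=> z /=; rewrite !in_itv /= ltrBlDr lerBrDr.
have /= -> := @lebesgue_measure_itv R `]x - a, y - a].
by rewrite lebesgue_measure_itv /= !lte_fin ltrD2r -!EFinB [in RHS]opprB addrA subrK.
Qed.

Definition unit_measure (R : realType) : set (measurableTypeR R) -> \bar R :=
  mrestr lebesgue_measure (measurable_itv `[0 : R, 1[).

HB.instance Definition _ (R : realType) := Measure.on (@unit_measure R).

Fact unit_measure_setT (R : realType) : @unit_measure R setT = 1%E.
Proof.
by rewrite /unit_measure /mrestr setTI lebesgue_measure_itv /= lte_fin ltr01 sube0.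
Qed.

HB.instance Definition _ (R : realType) :=
  Measure_isProbability.Build _ _ _ (@unit_measure R) (@unit_measure_setT R).

(** For 0 <= a < 1 the points of [0, 1[ split into those that do not wrap around and those that do;
    the two pieces are translates of the parts of A in [a, 1[ and in [0, a[. *)
Lemma unit_measure_rotation (R : realType) (a : R) (A : set R) :
  measurable (A : set (measurableTypeR R)) ->
  unit_measure [set x | A (frac (x + a))] = unit_measure A.
Proof.
move=> mA; rewrite /unit_measure /mrestr.
wlog a01 : a / 0 <= a < 1 => [hwlog|].
  rewrite -(hwlog (frac a)) ?frac_itv //; congr (lebesgue_measure (_ `&` _)).
  apply/funext => x /=.
  have -> : x + frac a = x + a + (- Num.floor a)%:~R by rewrite intrN -addrA.
  by rewrite fracDz.
have /andP[a0 a1] := a01.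
have mI (i : interval R) : measurable ([set` i] : set (measurableTypeR R)) by exact: measurable_itv.
have mS (B : set (measurableTypeR R)) (b : R) : measurable B ->
    measurable [set x : measurableTypeR R | B (x + b)].
  by move=> mB; rewrite -[X in measurable X]setTI; exact: measurable_shift.
have -> : [set x | A (frac (x + a))] `&` `[0, 1[ =
    [set x | (A `&` `[a, 1[) (x + a)] `|` [set x | (A `&` `[0, a[) (x + (a - 1))].
  apply/seteqP; split=> x; rewrite /= !in_itv /=.
    move=> [Ax /andP[x0 x1]]; have [xa|xa] := ltP (x + a) 1.
      left; move: Ax; rewrite frac_id; last by apply/andP; split; lra.
      by split=> //; apply/andP; split; lra.
    right; have fE : frac (x + a) = x + (a - 1).
      rewrite -(@frac_id _ (x + (a - 1))); last by apply/andP; split; lra.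
      by rewrite addrA -[- 1]/((- 1%:Z)%:~R) fracDz.
    by rewrite -fE; split=> //; rewrite fE; apply/andP; split; lra.
  move=> [[Ax /andP[h1 h2]]|[Ax /andP[h1 h2]]].
    by split; [rewrite frac_id //|]; apply/andP; split; lra.
  split; last by apply/andP; split; lra.
  rewrite (_ : x + a = x + (a - 1) + 1%:~R); last by rewrite addrA subrK.
  by rewrite fracDz frac_id //; apply/andP; split; lra.
rewrite measureU; first last.
- apply/seteqP; split=> x //= [[_]]; rewrite !in_itv /= => /andP[h1 h2] [_ /andP[h3 h4]]; lra.
- by apply: mS; exact: measurableI.
- by apply: mS; exact: measurableI.
transitivity (lebesgue_measure (A `&` `[a, 1%R[) + lebesgue_measure (A `&` `[0%R, a[))%E.
  by congr (_ + _)%E; apply: lebesgue_measure_shift; exact: measurableI.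
rewrite addeC -measureU; [|exact: measurableI|exact: measurableI|]; last first.
  by apply/seteqP; split=> x //= [[_]]; rewrite !in_itv /= => /andP[h1 h2] [_ /andP[h3 h4]]; lra.
rewrite -setIUr; congr (lebesgue_measure (A `&` _)).
apply/seteqP; split=> x /=; rewrite !in_itv /=.
  by move=> [] /andP[h1 h2]; apply/andP; split; lra.
by move=> /andP[h1 h2]; have [xa|xa] := ltP x a; [left|right]; apply/andP; split; lra.
Qed.

Lemma countable_bigcup_measurable d (T : sigmaRingType d) (I : Type) (D : set I)
    (F : I -> set T) : countable D -> (forall i, D i -> measurable (F i)) ->
  measurable (\bigcup_(i in D) F i).
Proof.
move=> cD mF; rewrite bigcup_set_type; apply: countable_bigcupT_measurable.
  by rewrite (eq_countable (card_setT D)).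
by move=> i; apply: mF; exact: set_valP.
Qed.

Lemma borel_measurability d (T : measurableType d) (H : topologicalGroupType)
    (f : T -> H) : (forall U : set H, open U -> measurable (f @^-1` U)) ->
  measurable_fun setT (f : T -> borel H).
Proof.
move=> mf.
have := @measurability _ _ T (borel H) setT f (@open (pointed_group H)) erefl.
apply.
by move=> _ [U oU <-]; rewrite setTI; exact: mf.
Qed.

Lemma continuous_borel_map (G H : topologicalGroupType) (f : G -> H) :
  continuous f -> measurable_fun setT (f : borel G -> borel H).
Proof.
move=> /continuousP cf; apply: borel_measurability => U oU.
by apply: open_borel; exact: cf.
Qed.

(* Second countability makes every open subset of the product a countable union
   of open rectangles. *)
Lemma continuous_borel_prod (G1 G2 H : topologicalGroupType) (f : G1 * G2 -> H) :
  @second_countable G1 -> @second_countable G2 -> continuous f ->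
  measurable_fun setT (f : borel G1 * borel G2 -> borel H).
Proof.
move=> [B1 cB1 [oB1 bB1]] [B2 cB2 [oB2 bB2]] /continuousP cf.
apply: borel_measurability => U /cf; set W := f @^-1` U => oW.
pose I := [set b : set G1 * set G2 | [/\ B1 b.1, B2 b.2 & b.1 `*` b.2 `<=` W]].
have -> : W = \bigcup_(b in I) (b.1 `*` b.2).
  apply/seteqP; split=> [[x y] Wxy|[x y] [b [_ _ bW] bxy]]; last exact: bW.
  have [[N1 N2] [/= xN1 yN2] N12] : nbhs (x, y) W by exact: open_nbhs_nbhs.
  have [b1 [Bb1 b1x] b1N] := bB1 x _ xN1; have [b2 [Bb2 b2y] b2N] := bB2 y _ yN2.
  exists (b1, b2) => //; split=> // -[x' y'] [/= /b1N ? /b2N ?]; exact: N12.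
apply: countable_bigcup_measurable.
  apply: (@sub_countable _ _ _ (B1 `*` B2)); last exact: countableX.
  by apply: subset_card_le => b [].
move=> [b1 b2] [/= /oB1 ob1 /oB2 ob2 _].
by apply: measurableX; exact: open_borel.
Qed.

(** The preimage under translation by h is the image under translation by its inverse. Preimages are
    the form in which image measures are computed. *)
Lemma haar_preimage (R : realType) (G : topologicalGroupType)
    (mu : probability (borel G) R) (h : G) (A : set (borel G)) :
  haar_probability mu -> measurable A -> mu [set x | A (h * x)%g] = mu A.
Proof.
move=> Hmu mA; rewrite -(Hmu h^-1%g A mA); congr (mu _).
apply/seteqP; split=> [x /= Ax|_ [x Ax <-]] /=; last by rewrite mulVKg.
by exists (h * x)%g => //; rewrite mulKg.
Qed.

Lemma continuous_mull (G : topologicalGroupType) (h : G) :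
  continuous (fun x : G => (h * x)%g).
Proof.
move=> x.
apply: (@continuous_comp _ _ _ (fun x => (h, x)) (fun p : G * G => (p.1 * p.2)%g)).
  by apply: cvg_pair; [exact: cvg_cst|move=> A].
exact: mulg_continuous.
Qed.

Lemma measurable_translation (G : topologicalGroupType) (h : G) :
  measurable_fun setT ((fun x => (h * x)%g) : borel G -> borel G).
Proof. by apply: continuous_borel_map; exact: continuous_mull. Qed.

Lemma haar_probabilityP (R : realType) (G : topologicalGroupType)
    (mu : probability (borel G) R) :
  (forall (h : G) (A : set (borel G)), measurable A -> mu [set x | A (h * x)%g] = mu A) ->
  haar_probability mu.
Proof.
move=> H h A mA; rewrite -(H h^-1%g A mA); congr (mu _).
apply/seteqP; split=> [_ [x Ax <-]|x /= Ax] /=; first by rewrite mulKg.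
by exists (h^-1 * x)%g => //; rewrite mulVKg.
Qed.

(** Translation by f (h1, h2) lifts along f to the translation [t] of the product, and the product
    measure is invariant under [t] because both agree on rectangles. *)
Lemma haar_image (R : realType) (G1 G2 H : topologicalGroupType) (f : G1 * G2 -> H)
    (mu1 : probability (borel G1) R) (mu2 : probability (borel G2) R) :
  haar_probability mu1 -> haar_probability mu2 ->
  measurable_fun setT (f : borel G1 * borel G2 -> borel H) ->
  (forall x1 x2 y1 y2, f ((x1 * y1)%g, (x2 * y2)%g) = (f (x1, x2) * f (y1, y2))%g) ->
  (forall h, exists x, f x = h) ->
  exists mu : probability (borel H) R, haar_probability mu.
Proof.
move=> H1 H2 mf fM fsurj.
have [Q QE] := image_probability (mu1 \x mu2)%E mf.
exists Q; apply: haar_probabilityP => h A mA.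
have [[h1 h2] <-] := fsurj h.
pose t (x : borel G1 * borel G2) : borel G1 * borel G2 := ((h1 * x.1)%g, (h2 * x.2)%g).
have mt : measurable_fun setT t.
  by apply: measurable_fun_pair; apply: measurableT_comp => //; exact: measurable_translation.
have [P PE] := image_measure (mu1 \x mu2)%E mt.
rewrite !QE.
have -> : f @^-1` [set x | A (f (h1, h2) * x)%g] = t @^-1` (f @^-1` A).
  by apply/seteqP; split=> -[x y] /=; rewrite fM.
rewrite -PE; apply/esym/product_measure_unique; last first.
  by rewrite -[X in measurable X]setTI; exact: mf.
move=> B C mB mC; rewrite PE.
have -> : t @^-1` (B `*` C) = [set x | B (h1 * x)%g] `*` [set x | C (h2 * x)%g].
  by apply/seteqP; split=> -[x y].
transitivity (mu1 [set x | B (h1 * x)%g] * mu2 [set x | C (h2 * x)%g])%E; last first.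
  by congr (_ * _)%E; exact: haar_preimage.
apply: product_measure1E; rewrite -[X in measurable X]setTI;
  exact: measurable_translation.
Qed.

Lemma row_mx_continuous (R : realType) (m n : nat) :
  continuous (fun p : 'rV[R]_m * 'rV[R]_n => row_mx p.1 p.2).
Proof.
apply: rV_continuous => i; case: (split_ordP i) => j ->.
  under eq_fun do rewrite row_mxEl.
  move=> p; apply: (@continuous_comp _ _ _ fst (fun M : 'rV[R]_m => M 0 j)).
    exact: cvg_fst.
  exact: coord_continuous.
under eq_fun do rewrite row_mxEr.
move=> p; apply: (@continuous_comp _ _ _ snd (fun M : 'rV[R]_n => M 0 j)).
  exact: cvg_snd.
exact: coord_continuous.
Qed.

(** The image of the uniform measure on [0, 1[: translating by h on the circle amounts to rotating
    [0, 1[ by the coordinate of h. *)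
Lemma circle_haar (R : realType) :
  exists mu : probability (borel (torus R 1)) R, haar_probability mu.
Proof.
pose phi (x : measurableTypeR R) : borel (torus R 1) := tproj (const_mx x).
have mphi : measurable_fun setT phi.
  apply: borel_measurability => U oU; apply: open_measurable.
  apply: (open_comp _ oU) => x _.
  apply: (@continuous_comp _ _ _ (fun x : R => const_mx x : 'rV[R]_1) (@tproj R 1)).
    apply: rV_continuous => i; under eq_fun do rewrite mxE.
    by move=> z A.
  exact: tproj_continuous.
have [Q QE] := image_probability (@unit_measure R) mphi.
exists Q; apply: haar_probabilityP => h A mA.
rewrite !QE.
transitivity (unit_measure [set x | (phi @^-1` A) (frac (x + h 0 0))]); last first.
  by apply: unit_measure_rotation; rewrite -[X in measurable X]setTI; exact: mphi.
congr (unit_measure _); apply/funext => x /=; congr A.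
rewrite -[X in (X * _)%g]tproj_val -tprojD.
rewrite -[RHS](tproj_addz _ (const_mx (Num.floor (x + h 0 0)))); congr tproj.
by apply/rowP => i; rewrite !mxE !ord1 subrK addrC.
Qed.

Lemma torus_haar (R : realType) (n : nat) :
  exists mu : probability (borel (torus R n)) R, haar_probability mu.
Proof.
elim: n => [|n [mu Hmu]].
  (* In dimension 0 the torus is a single point. *)
  exists (\d_(1%g : borel (torus R 0))); apply: haar_probabilityP => h A mA.
  congr dirac; apply/funext => x /=; congr A.
  by apply/val_inj/rowP => -[].
have [nu Hnu] := circle_haar R.
pose f (p : torus R 1 * torus R n) : torus R (1 + n) :=
  tproj (row_mx (p.1 : 'rV_1) (p.2 : 'rV_n)).
(* Concatenation is compatible with integer shifts, so f may be computed on arbitrary lifts. *)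
have fE v w : f (tproj v, tproj w) = tproj (row_mx v w).
  have [a va] := val_tproj v; have [b wb] := val_tproj w.
  rewrite /f /= [in RHS]va [in RHS]wb -add_row_mx -map_row_mx.
  by rewrite tproj_addz.
apply: (@haar_image R (torus R 1) (torus R n) (torus R (1 + n)) f nu mu) => //.
- apply: continuous_borel_prod; [exact: torus_second_countable..|].
  move=> [p q] A /nbhs_tproj pqA.
  have [[B1 B2] [/= pB1 qB2] B12] := @row_mx_continuous R 1 n (p : 'rV_1, q : 'rV_n) _ pqA.
  exists (@tproj R 1 @` B1, @tproj R n @` B2).
    by split=> /=; [rewrite -[p]tproj_val|rewrite -[q]tproj_val]; exact: nbhs_image_tproj.
  by move=> [_ _] [/= [x B1x <-] [y B2y <-]]; rewrite /= fE; exact: (B12 (x, y)).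
- by move=> x1 x2 y1 y2; rewrite fE -add_row_mx tprojD.
- move=> h; exists (tproj (lsubmx (h : 'rV_(1 + n))), tproj (rsubmx (h : 'rV_(1 + n)))).
  by rewrite fE hsubmxK tproj_val.
Qed.

(** * Characters of the torus and induced representations *)

Section Translation.
Variables (R : realType) (H : topologicalGroupType).
Hypothesis compH : compact [set: H].
Variable mu : probability (borel H) R.
Hypothesis haar_mu : haar_probability mu.

Lemma Rintegral_translation (h : H) (f : H -> R) : continuous f ->
  Rintegral mu setT (fun x => f (h * x)%g) = Rintegral mu setT f.
Proof.
move=> cf; rewrite /Rintegral; congr fine.
have mt := measurable_translation h.
have cfh : continuous (fun x => f (h * x)%g).
  by move=> x; apply: continuous_comp; [exact: continuous_mull|exact: cf].
have := @integral_pushforward _ _ _ _ R _ mt mu setT (EFin \o f).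
rewrite preimage_setT => /(_ _ _ measurableT) <-.
- apply: eq_measure_integral => A mA _.
  exact: haar_preimage.
- by apply/measurable_EFinP; exact: continuous_borel.
- exact: (continuous_integrable compH mu cfh).
Qed.

Lemma cintegral_translation (h : H) (f : H -> R[i]) : continuous f ->
  cintegral mu (fun x => f (h * x)%g) = cintegral mu f.
Proof.
move=> /continuous_ReIm[cf1 cf2]; rewrite /cintegral.
by rewrite (Rintegral_translation h cf1) (Rintegral_translation h cf2).
Qed.

(** Translating by h multiplies the integral by [chi h], yet leaves it unchanged. *)
Lemma cintegral_character_eq0 (chi : H -> R[i]) (h : H) : continuous chi ->
  (forall x y, chi (x * y)%g = chi x * chi y) -> chi h != 1 ->
  cintegral mu chi = 0.
Proof.
move=> cchi chiM h1; have := cintegral_translation h cchi.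
under [X in cintegral mu X]eq_fun do rewrite chiM.
rewrite cintegralZ // => /eqP; rewrite -subr_eq0 -[X in _ - X]mul1r -mulrBl mulf_eq0.
by rewrite subr_eq0 (negPf h1) => /eqP.
Qed.

Lemma continuous_sum (I : Type) (r : seq I) (F : I -> H -> R[i]) :
  (forall i, continuous (F i)) -> continuous (fun x => \sum_(i <- r) F i x).
Proof.
move=> cF; elim: r => [|i r IH].
  under eq_fun do rewrite big_nil; exact: cst_continuous.
under eq_fun do rewrite big_cons.
by move=> x; apply: cvgD; [exact: cF|exact: IH].
Qed.

Lemma cintegral_sum_eq0 (I : Type) (r : seq I) (F : I -> H -> R[i]) :
  (forall i, continuous (F i)) -> (forall i, cintegral mu (F i) = 0) ->
  cintegral mu (fun x => \sum_(i <- r) F i x) = 0.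
Proof.
move=> cF F0; elim: r => [|i r IH].
  under [X in cintegral mu X]eq_fun do rewrite big_nil.
  by rewrite /cintegral /= !Rintegral_cst // !mul0r.
under [X in cintegral mu X]eq_fun do rewrite big_cons.
by rewrite cintegralD // ?F0 ?IH ?addr0 //; exact: continuous_sum.
Qed.

End Translation.

Section Exponential.
Variable R : realType.
Implicit Types s t : R.

Definition expi t : R[i] := cos (2 * pi * t) +i* sin (2 * pi * t).

Lemma expiD s t : expi (s + t) = expi s * expi t.
Proof.
rewrite /expi mulrDr cosD sinD; apply/eqP; rewrite eq_complex /=.
by rewrite eqxx /= addrC.
Qed.

Lemma expi0 : expi 0 = 1.
Proof. by rewrite /expi mulr0 cos0 sin0. Qed.

Lemma expi_half : expi 2^-1 = -1.
Proof.
rewrite /expi mulrAC divff // mul1r cospi sinpi.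
by apply/eqP; rewrite eq_complex /= oppr0 !eqxx.
Qed.

Lemma expi_int (m : int) : expi m%:~R = 1.
Proof.
have expi_nat (n : nat) : expi n%:R = 1.
  elim: n => [|n IH]; first exact: expi0.
  rewrite -natr1 expiD IH mul1r.
  have -> : 1 = 2^-1 + 2^-1 :> R by rewrite [LHS]splitr !mul1r.
  by rewrite expiD expi_half mulrNN mulr1.
case: m => n; first exact: expi_nat.
have := expiD n.+1%:R (- n.+1%:R); rewrite subrr expi0 expi_nat mul1r => ->.
by rewrite NegzE intrN.
Qed.

Lemma conj_expi t : Num.conj (expi t) = expi (- t).
Proof. by rewrite /expi mulrN cosN sinN. Qed.

Lemma expi_continuous : continuous expi.
Proof.
apply: continuous_complex => t.
  apply: (@continuous_comp _ _ _ (fun t => 2 * pi * t) (@cos R)).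
    exact: mulrl_continuous.
  exact: continuous_cos.
apply: (@continuous_comp _ _ _ (fun t => 2 * pi * t) (@sin R)).
  exact: mulrl_continuous.
exact: continuous_sin.
Qed.

End Exponential.

Section Characters.
Variables (R : realType) (n : nat).
Local Notation T := (torus R n).
Implicit Types (a b : 'rV[int]_n) (v w : 'rV[R]_n) (p q : T).

Definition pairing a v : R := \sum_i (a 0 i)%:~R * v 0 i.

Lemma pairingDl a b v : pairing (a + b) v = pairing a v + pairing b v.
Proof. by rewrite -big_split; apply: eq_bigr => i _; rewrite mxE intrD mulrDl. Qed.

Lemma pairingDr a v w : pairing a (v + w) = pairing a v + pairing a w.
Proof. by rewrite -big_split; apply: eq_bigr => i _; rewrite mxE mulrDr. Qed.

Lemma pairing_int a (m : 'rV[int]_n) :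
  pairing a (map_mx intr m) = (\sum_i a 0 i * m 0 i)%:~R.
Proof. by rewrite [RHS]rmorph_sum; apply: eq_bigr => i _; rewrite mxE rmorphM. Qed.

Lemma pairing_continuous a : continuous (pairing a).
Proof.
have -> : pairing a = \sum_i (fun v : 'rV[R]_n => (a 0 i)%:~R * v 0 i).
  by apply/funext => v; rewrite fct_sumE.
apply: (big_ind (fun u : 'rV[R]_n -> R => continuous u)).
- exact: cst_continuous.
- by move=> u v cu cv x; apply: (@continuousD _ _ _ u v); [exact: cu | exact: cv].
- move=> i _ x.
  apply: (@continuous_comp _ _ _ (fun v : 'rV[R]_n => v 0 i) ( *%R (a 0 i)%:~R)).
    exact: coord_continuous.
  exact: mulrl_continuous.
Qed.

Definition torus_char a p : R[i] := expi (pairing a p).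

(** Changing the lift by an integer vector changes the pairing by an integer, because a is integral,
    and [expi] is 1 on integers. *)
Lemma torus_char_proj a v : torus_char a (tproj v) = expi (pairing a v).
Proof.
have [m vE] := val_tproj v.
by rewrite [in RHS]vE pairingDr pairing_int expiD expi_int mulr1.
Qed.

Lemma torus_charM a p q : torus_char a (p * q)%g = torus_char a p * torus_char a q.
Proof.
rewrite -[(p * q)%g]/(tproj ((p : 'rV[R]_n) + (q : 'rV[R]_n))) torus_char_proj.
by rewrite pairingDr expiD.
Qed.

Lemma torus_charD a b p : torus_char (a + b) p = torus_char a p * torus_char b p.
Proof. by rewrite /torus_char pairingDl expiD. Qed.

Lemma torus_char0 p : torus_char 0 p = 1.
Proof.
rewrite /torus_char (_ : pairing 0 p = 0) ?expi0 //.
by apply: big1 => i _; rewrite mxE mul0r.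
Qed.

Lemma conj_torus_char a p : Num.conj (torus_char a p) = torus_char (- a) p.
Proof.
rewrite /torus_char conj_expi; congr expi; rewrite -sumrN.
by apply: eq_bigr => i _; rewrite mxE intrN mulNr.
Qed.

Lemma torus_char_continuous a : continuous (torus_char a).
Proof.
apply: continuous_torus.
have -> : torus_char a \o @tproj R n = @expi R \o pairing a.
  by apply/funext => v; exact: torus_char_proj.
by move=> v; apply: continuous_comp; [exact: pairing_continuous|exact: expi_continuous].
Qed.

Lemma torus_char_nontrivial a : a != 0 -> exists p, torus_char a p != 1.
Proof.
move=> /eqP a0; have [i ai] : exists i, a 0 i != 0.
  apply: contrapT => H; apply: a0; apply/rowP => i; rewrite mxE.
  by apply/eqP; apply: contrapT => /negP ai; apply: H; exists i.
(* At the point e_i / (2 a_i) the pairing is 1/2, so the character takes the value -1. *)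
exists (tproj (((a 0 i)%:~R^-1 * 2^-1) *: delta_mx 0 i)).
rewrite torus_char_proj /pairing (bigD1 i) //= big1 ?addr0; last first.
  by move=> j ji; rewrite !mxE eqxx (negPf ji) !mulr0.
rewrite !mxE !eqxx mulr1 mulrA divff ?intr_eq0 // mul1r expi_half.
by rewrite eq_sym -subr_eq0 opprK -(natrD _ 1 1) pnatr_eq0.
Qed.

Lemma cintegral_torus_char (mu : probability (borel T) R) a :
  haar_probability mu -> a != 0 -> cintegral mu (torus_char a) = 0.
Proof.
move=> Hmu /torus_char_nontrivial[p p1].
apply: (cintegral_character_eq0 (@torus_compact R n) Hmu _ _ p1).
  exact: torus_char_continuous.
exact: torus_charM.
Qed.

End Characters.

Section Induced.
Variables (R : realType) (Gamma : groupType) (Lam : set Gamma).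
Hypotheses (Lam1 : Lam 1%g) (LamM : forall g h, Lam g -> Lam h -> Lam (g * h)%g)
  (LamV : forall g, Lam g -> Lam g^-1%g).

(** Thins a finite family meeting every left coset of [Lam] to one representative per coset, by
    keeping an element only if its coset is new. *)
Lemma subgroup_transversal (S : seq Gamma) :
  (forall g, exists2 s, s \in S & Lam (s^-1 * g)%g) ->
  exists k (t : 'I_k.+1 -> Gamma),
    (forall g, exists i, Lam ((t i)^-1 * g)%g) /\
    (forall i j, Lam ((t i)^-1 * t j)%g -> i = j).
Proof.
move=> coverS.
have [S' [covS' uniqS']] : exists S' : seq Gamma,
    (forall s, s \in S -> exists2 i, (i < size S')%N & Lam ((nth 1 S' i)^-1 * s)%g) /\
    (forall i j, (i < size S')%N -> (j < size S')%N ->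
      Lam ((nth 1 S' i)^-1 * nth 1 S' j)%g -> i = j).
  elim: S {coverS} => [|s S [S' [covS' uniqS']]]; first by exists [::].
  have [[i iS' si]|nos] := pselect (exists2 i, (i < size S')%N & Lam ((nth 1 S' i)^-1 * s)%g).
    exists S'; split=> // u; rewrite inE => /orP[/eqP->|/covS' //].
    by exists i.
  exists (s :: S'); split=> [u|].
    rewrite inE => /orP[/eqP->|/covS'[i iS' iu]]; last by exists i.+1.
    by exists 0%N; rewrite //= mulVg.
  move=> [|i] [|j] //= iS' jS'.
  - by move=> /LamV; rewrite invgM invgK => H; case: nos; exists j.
  - by move=> H; case: nos; exists i.
  - by move=> /(uniqS' _ _ iS' jS') ->.
(* The coset of 1 is represented, so the list is nonempty, as the matrix size k+1 demands. *)
have [k kE] : exists k, size S' = k.+1.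
  have [s sS _] := coverS 1%g; have [i iS' _] := covS' s sS.
  by exists (size S').-1; rewrite prednK // (leq_ltn_trans _ iS').
exists k, (fun i => nth 1%g S' i); split=> [g|i j /uniqS' ij].
  have [s sS sg] := coverS g; have [i iS' si] := covS' s sS.
  rewrite kE in iS'; exists (Ordinal iS') => /=.
  by have := LamM si sg; rewrite mulgA mulgK.
by apply/val_inj/ij; rewrite kE.
Qed.

Variables (n : nat) (c : Gamma -> 'rV[int]_n).
Hypotheses (cM : forall g h, Lam g -> Lam h -> c (g * h)%g = c g + c h)
  (c_inj : forall g, Lam g -> c g = 0 -> g = 1%g).

Variables (k : nat) (t : 'I_k.+1 -> Gamma).
Hypotheses (cover_t : forall g, exists i, Lam ((t i)^-1 * g)%g)
  (uniq_t : forall i j, Lam ((t i)^-1 * t j)%g -> i = j).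

Let c1 : c 1%g = 0.
Proof.
have := cM Lam1 Lam1; rewrite mulg1 => /eqP.
by rewrite addrC -subr_eq subrr eq_sym => /eqP.
Qed.

Let cV g : Lam g -> c g^-1%g = - c g.
Proof.
move=> Lg; apply/eqP; rewrite -addr_eq0 -cM //; last exact: LamV.
by rewrite mulVg c1.
Qed.

(* The representation induced from the character [torus_char (c g) x] of [Lam],
   in the basis indexed by the transversal [t]. *)
Definition partial_char (g : Gamma) (x : torus R n) : R[i] :=
  if `[< Lam g >] then torus_char (c g) x else 0.

Definition induced_mx (g : Gamma) (x : torus R n) : 'M[R[i]]_k.+1 :=
  \matrix_(i, j) partial_char ((t i)^-1 * g * t j)%g x.

Lemma partial_char_continuous g : continuous (partial_char g).
Proof.
rewrite /partial_char; case: asboolP => _; first exact: torus_char_continuous.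
exact: cst_continuous.
Qed.

Lemma induced_mx_continuous g : continuous (induced_mx g).
Proof.
apply: mx_continuous => i j; under eq_fun do rewrite mxE.
exact: partial_char_continuous.
Qed.

(** Column j of the matrix of h has a single nonzero entry, in the row l of the coset of h t_j. For
    this l the entry (i, j) of the matrix of gh is nonzero exactly when the entry (i, l) of that of
    g is. *)
Lemma induced_mxM g h x : induced_mx (g * h)%g x = induced_mx g x *m induced_mx h x.
Proof.
apply/matrixP => i j; rewrite !mxE.
have [l Hl] := cover_t (h * t j)%g; rewrite mulgA in Hl.
rewrite (bigD1 l) //= big1 ?addr0 => [|m ml]; rewrite !mxE /partial_char; last first.
  case: (asboolP (Lam ((t m)^-1 * h * t j)%g)) => [Hm|_]; last by rewrite mulr0.
  case/eqP: ml; apply: uniq_t; have := LamM Hm (LamV Hl).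
  by rewrite !invgM invgK !mulgA mulgK mulgK.
rewrite (asboolT Hl).
have e : ((t i)^-1 * (g * h) * t j = ((t i)^-1 * g * t l) * ((t l)^-1 * h * t j))%g.
  by rewrite !mulgA mulgK.
case: asboolP => [L1|nL1].
  have L2 : Lam ((t i)^-1 * g * t l)%g.
    by have := LamM L1 (LamV Hl); rewrite e mulgK.
  by rewrite asboolT // e cM // torus_charD.
case: asboolP => [L2|_]; last by rewrite mul0r.
by case: nL1; rewrite e; exact: LamM.
Qed.

Lemma induced_mx1 x : induced_mx 1%g x = 1%:M.
Proof.
apply/matrixP => i j; rewrite !mxE mulg1 /partial_char.
have [->|ij] := eqVneq i j; first by rewrite mulVg asboolT // c1 torus_char0.
by case: asboolP => // /uniq_t ij'; rewrite ij' eqxx in ij.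
Qed.

Lemma induced_mx_adj g x : (induced_mx g x)^t* = induced_mx g^-1%g x.
Proof.
apply/matrixP => i j; rewrite !mxE /partial_char.
have e : ((t i)^-1 * g^-1 * t j = ((t j)^-1 * g * t i)^-1)%g.
  by rewrite !invgM invgK mulgA.
case: asboolP => [L1|nL1].
  by rewrite conj_torus_char e asboolT ?cV //; exact: LamV.
case: asboolP => [L2|_]; last by rewrite conjC0.
by case: nL1; rewrite -[X in Lam X]invgK -e; exact: LamV.
Qed.

Lemma induced_traceless_model : admits_traceless_model R Gamma.
Proof.
have [mu Hmu] := torus_haar R n.
pose rho g : mxcont R (torus R n) k :=
  (mkcts (@induced_mx_continuous g) : continuousType _ _).
have rho0 g : g != 1%g -> tr_int mu (rho g) = 0.
  move=> g1; rewrite /tr_int.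
  under [X in cintegral mu X]eq_fun do rewrite mulrC.
  rewrite cintegralZ; [|exact: torus_compact|]; last first.
    apply: continuous_sum => i; under eq_fun do rewrite mxE.
    exact: partial_char_continuous.
  rewrite (@cintegral_sum_eq0 _ _ (@torus_compact R n)) ?mulr0 // => i.
    by under eq_fun do rewrite mxE; exact: partial_char_continuous.
  under [X in cintegral mu X]eq_fun do rewrite mxE /partial_char.
  case: asboolP => [L|_]; last by rewrite /cintegral /= !Rintegral_cst // !mul0r.
  (* A zero exponent would make the conjugate of g, and hence g itself, trivial. *)
  apply: cintegral_torus_char => //; apply: contra g1 => /eqP /(c_inj L).
  move=> /(congr1 (fun z => t i * z * (t i)^-1)%g).
  by rewrite !mulgA mulgV mul1g mulgK mulg1 mulgV => ->.
exists (torus R n : compactLieGroupType R), mu, k, rho; split=> //.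
- split=> [g x|g h x]; last exact: induced_mxM.
  apply/unitarymxP; rewrite /mxcont_fun /= induced_mx_adj -induced_mxM mulgV.
  exact: induced_mx1.
(* If g and h had the same image, g h^-1 would be sent to 1, whose integrated trace is 1 and not
   0. *)
- move=> g h gh; apply/eqP; rewrite -[_ == _]negbK; apply/negP => gh1.
  have gh2 : (g * h^-1)%g != 1%g by apply: contra gh1 => /eqP/divg1_eq ->.
  have : rho (g * h^-1)%g = 1.
    apply: mxcontP => x; rewrite -[LHS]/(induced_mx (g * h^-1)%g x) induced_mxM.
    have -> : induced_mx g x = induced_mx h x.
      by rewrite -[LHS]/(rho g x) gh.
    by rewrite -induced_mxM mulgV induced_mx1.
  move=> e; have := rho0 _ gh2; rewrite e tr_int1 => /eqP; rewrite oner_eq0 //.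
Qed.

End Induced.

(** * Finitely generated abelian groups *)

Section FinitelyGeneratedZmodule.
Variable V : zmodType.

(** The recursive form peels off one generator at a time, which is the induction used to find a free
    subgroup of finite index. *)
Fixpoint zspan (s : seq V) : set V :=
  if s is g :: s' then [set v | exists z : int, exists2 w, zspan s' w & v = g *~ z + w]
  else [set 0].

Lemma zspan0 s : zspan s 0.
Proof. by elim: s => //= g s IH; exists 0, 0; rewrite // mulr0z addr0. Qed.

Lemma zspanD s v w : zspan s v -> zspan s w -> zspan s (v + w).
Proof.
elim: s v w => [|g s IH] v w /=; first by move=> -> ->; rewrite addr0.
move=> [y [v' v's ->]] [z [w' w's ->]]; exists (y + z), (v' + w'); first exact: IH.
by rewrite mulrzDr addrACA.
Qed.

Lemma zspanN s v : zspan s v -> zspan s (- v).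
Proof.
elim: s v => [|g s IH] v /=; first by move=> ->; rewrite oppr0.
by move=> [y [w ws ->]]; exists (- y), (- w); [exact: IH|rewrite opprD mulrNz].
Qed.

Lemma mem_zspan s v : v \in s -> zspan s v.
Proof.
elim: s => //= g s IH; rewrite inE => /orP[/eqP->|/IH vs].
  by exists 1, 0; [exact: zspan0|rewrite mulr1z addr0].
by exists 0, v => //; rewrite mulr0z add0r.
Qed.

(* [phi] is spanned by a maximal independent family of elements of [s]: every
   other generator has a nonzero multiple in the span of that family. *)
Lemma zspan_free_finite_index (s : seq V) :
  exists r (phi : {additive 'rV[int]_r -> V}) (S : seq V),
    injective phi /\
    (forall v, zspan s v -> exists2 w, w \in S & exists a, v = w + phi a).
Proof.
elim: s => [|g s [r [phi [S [phi_inj cover]]]]].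
  exists 0%N, \0%R, [:: 0]; split=> [a b _|v ->]; first by apply/rowP => -[].
  by exists 0; rewrite ?inE //; exists 0; rewrite addr0.
have [[m [m0 [a ga]]]|indep] := pselect (exists m : nat, (0 < m)%N /\ exists a, g *+ m = phi a).
  (* As m g already lies in the range of [phi], dividing z by m leaves only the remainders i < m to
     be added to the representatives. *)
  exists r, phi, [seq w + g *+ i | w <- S, i <- iota 0 m]; split=> // v.
  move=> [z [w /cover[u uS [b ->]] ->]].
  have mz : (m%:Z) != 0 by rewrite eqz_nat -lt0n.
  have := modz_ge0 z mz; case zE : (modz z m) => [i|//] _.
  have im : (i < m)%N by rewrite -ltz_nat -zE ltz_pmod.
  exists (u + g *+ i); first by apply/allpairsP; exists (u, i); rewrite mem_iota.
  exists (a *~ (divz z m) + b).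
  have zg : g *~ z = g *+ i + (g *+ m) *~ divz z m.
    by rewrite [in LHS](divz_eq z m) zE mulrzDr mulrC mulrzA addrC.
  by rewrite zg raddfD raddfMz -ga addrACA [g *+ i + u]addrC.
(* Here g is independent of the range of [phi]: the rank grows by one and the same representatives
   suffice. *)
pose psi (a : 'rV[int]_(1 + r)) : V := g *~ (lsubmx a 0 0) + phi (rsubmx a).
have psiB : zmod_morphism psi.
  by move=> a b; rewrite /psi !raddfB /= !mxE mulrzBr opprD addrACA.
pose Psi : {additive 'rV[int]_(1 + r) -> V} :=
  HB.pack psi (GRing.isZmodMorphism.Build _ _ psi psiB).
exists (1 + r)%N, Psi, S; split; last first.
  move=> v [z [w /cover[u uS [b ->]] ->]]; exists u => //.
  exists (row_mx z%:M b); rewrite /Psi /= /psi row_mxKl row_mxKr mxE eqxx mulr1n.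
  by rewrite addrCA.
apply: raddf_inj => a; rewrite /Psi /= /psi => a0.
have z0 : lsubmx a 0 0 = 0.
  apply/eqP; apply: contrapT => /negP z0; apply: indep.
  move/eqP: a0; rewrite addr_eq0 -raddfN => /eqP a0.
  (* [indep] speaks of positive natural multiples, so the sign of the coefficient of g is absorbed
     into the argument of [phi]. *)
  case: (lsubmx a 0 0) z0 a0 => m m0 a0; last first.
    exists m.+1; split=> //; exists (rsubmx a).
    by move: a0; rewrite NegzE mulrNz raddfN => /oppr_inj.
  by exists m; split; [rewrite lt0n|exists (- rsubmx a)].
move: a0; rewrite z0 mulr0z add0r -(raddf0 phi) => /phi_inj r0.
rewrite -[a]hsubmxK r0 (_ : lsubmx a = 0) ?row_mx0 //.
by apply/rowP => i; rewrite ord1 z0 mxE.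
Qed.

End FinitelyGeneratedZmodule.

(** The proof [comm] is a parameter of the alias so that the additive structure attached to it can
    recover commutativity. *)
Definition additive_group (Gamma : groupType)
  (comm : forall g h : Gamma, (g * h = h * g)%g) : Type := Gamma.

Section AdditiveGroup.
Variables (Gamma : groupType) (comm : forall g h : Gamma, (g * h = h * g)%g).

HB.instance Definition _ := Choice.copy (additive_group comm) Gamma.
HB.instance Definition _ := GRing.isZmodule.Build (additive_group comm)
  (@mulgA Gamma) comm (@mul1g Gamma) (@mulVg Gamma).

End AdditiveGroup.

Lemma abelian_traceless_model (R : realType) (Gamma : groupType) :
  finitely_generated Gamma -> (forall g h : Gamma, (g * h = h * g)%g) ->
  admits_traceless_model R Gamma.
Proof.
move=> [s gens] comm.
pose V : zmodType := additive_group comm.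
have [r [phi [S [phi_inj cover]]]] := @zspan_free_finite_index V s.
(* Addition in [V] is the product of [Gamma] by conversion, so the generation hypothesis applies to
   the predicate [zspan s]. *)
have spanT (g : V) : zspan (s : seq V) g.
  apply: (gens (zspan (s : seq V))).
  - exact: (@mem_zspan V).
  - exact: (@zspan0 V).
  - exact: (@zspanD V).
  - exact: (@zspanN V).
pose Lam : set Gamma := range phi.
have Lam1 : Lam 1%g by exists 0; rewrite ?raddf0.
have LamM g h : Lam g -> Lam h -> Lam (g * h)%g.
  by move=> [a _ <-] [b _ <-]; exists (a + b); rewrite ?raddfD.
have LamV g : Lam g -> Lam g^-1%g.
  by move=> [a _ <-]; exists (- a); rewrite ?raddfN.
(* The inverse of [phi] on its range, with default value 0 elsewhere. *)
pose c (g : Gamma) := xget 0 [set a | phi a = g].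
have cphi a : c (phi a) = a.
  apply: phi_inj; rewrite /c.
  by have := @xgetPex _ 0 [set b | phi b = phi a] (ex_intro _ a erefl).
have coverS g : exists2 w, w \in S & Lam (w^-1 * g)%g.
  have [w wS [a ->]] := cover g (spanT g); exists w => //.
  by exists a => //; exact: (esym (@addKr V w (phi a))).
have [k [t [cover_t uniq_t]]] := subgroup_transversal Lam1 LamM LamV coverS.
apply: (induced_traceless_model R Lam1 LamM LamV (c := c)) cover_t uniq_t.
  move=> _ _ [a _ <-] [b _ <-]; rewrite !cphi -[RHS]cphi; congr c.
  exact: (esym (raddfD phi a b)).
by move=> _ [a _ <-]; rewrite cphi => ->; exact: (raddf0 phi).
Qed.

(** * Finite groups *)

Lemma finite_traceless_model (R : realType) (Gamma : groupType) :
  finite_set [set: Gamma] -> admits_traceless_model R Gamma.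
Proof.
move=> /finite_seqP[S SE].
pose Lam : set Gamma := [set 1%g].
have Lam1 : Lam 1%g by [].
have LamM g h : Lam g -> Lam h -> Lam (g * h)%g by move=> -> ->; rewrite /Lam /= mulg1.
have LamV g : Lam g -> Lam g^-1%g by move=> ->; rewrite /Lam /= invg1.
have coverS g : exists2 w, w \in S & Lam (w^-1 * g)%g.
  by exists g; [have : [set: Gamma] g by []; rewrite SE|rewrite /Lam /= mulVg].
have [k [t [cover_t uniq_t]]] := subgroup_transversal Lam1 LamM LamV coverS.
apply: (@induced_traceless_model R Gamma Lam Lam1 LamM LamV 0 (fun=> 0)) cover_t uniq_t => //.
by move=> g h _ _; rewrite addr0.
Qed.

Theorem proposition2p3 (R : realType) :
  (forall (Gamma : groupType) (H : compactLieGroupType R)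
      (mu : probability (borel H) R) (k : nat) (rho : Gamma -> mxcont R H k),
    finitely_generated Gamma -> haar_probability mu ->
    morphism_to_CHU rho -> injective rho ->
    forall (A : cstarAlgType R) (u : Gamma -> A) (tau : {scalar A})
      (pi : {lrmorphism A -> mxcont R H k}),
    full_group_cstar u -> haar_integration u tau -> induced_model u rho pi ->
    (forall g : Gamma, g != 1%g -> tr_int mu (rho g) = 0) ->
    stationary mu tau pi)
  /\
  (forall Gamma : groupType, finitely_generated Gamma ->
    (forall g h : Gamma, (g * h = h * g)%g) -> admits_traceless_model R Gamma)
  /\
  (forall Gamma : groupType, finite_set [set: Gamma] ->
    admits_traceless_model R Gamma).
Proof.
split; last by split; [exact: abelian_traceless_model|exact: finite_traceless_model].
move=> Gamma H mu k rho _ _ _ _ A u tau pi.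
apply: (@stationary_of_traceless R Gamma H mu k rho A u tau pi).
exact: compact_setT.
Qed.
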